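(* Let $\kappa > 0$ and $0 < \nu \le \frac12$. For each $t > 0$, the function $$p(x,t) = \frac{1}{2\sqrt{\kappa}}\, R_{1-\nu,\nu}\Big(\frac{|x|}{\sqrt{\kappa}},t\Big), \quad x \in \mathbb{R},$$ is the probability density function of some continuous random variable $X_t$. In the special case $\nu = \frac12$ and $\kappa = \frac12$, $X_t$ is normally distributed with mean $0$ and variance $t$.
   Context: For $\mu \ge 0$, $0<\nu\le 1$ and $a>0$, $R_{\mu,\nu}(a,t) = \mathcal{L}^{-1}\{s^{-\mu} e^{-a s^{\nu}};t\}$ for $t>0$, where $\mathcal{L}\{y(t);s\} = \int_0^\infty e^{-st} y(t)\, dt$ is the Laplace transform, $\mathcal{L}^{-1}$ is its inverse, and $s^\nu$ is the principal branch. The value of $p(x,t)$ at the single point $x=0$ (where $a=0$) is immaterial; it can be taken from the same formula with $a=0$. The function $p$ is the formal solution of the Caputo time-fractional diffusion equation of order $2\nu$ in time, with right-hand side $\kappa\, \partial^2 p/\partial x^2$ and initial condition $p(x,0)=\delta(x)$ (Dirac delta). *)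

(* Defs.v *)
From HB Require Import structures.
From mathcomp Require Import all_boot all_order all_algebra.
From mathcomp Require Import complex.
From mathcomp Require Import all_classical all_reals all_analysis.

Set Implicit Arguments.
Unset Strict Implicit.
Unset Printing Implicit Defensive.
Import Order.TTheory GRing.Theory Num.Theory.
Import numFieldNormedType.Exports.

Local Open Scope classical_set_scope.
Local Open Scope ring_scope.
Local Open Scope complex_scope.

Section ComplexFunctions.
Context {R : realType}.
Implicit Types z : R[i].

Definition cexp z : R[i] :=
  (expR (complex.Re z))%:C * (cos (complex.Im z) +i* sin (complex.Im z)).

Definition cmod z : R := Num.sqrt (complex.Re z ^+ 2 + complex.Im z ^+ 2).

(* Principal argument, with values in ]-pi, pi]; irrelevant at z = 0. *)
Definition carg z : R :=
  if 0 <= complex.Im z then acos (complex.Re z / cmod z)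
  else - acos (complex.Re z / cmod z).

(* Principal branch of z ^ b, with the same convention at z = 0 as powR. *)
Definition cpow z (b : R) : R[i] :=
  if z == 0 then (b == 0)%:R else cexp (b%:C * (ln (cmod z) +i* carg z)).

End ComplexFunctions.

Section LaplaceTransform.
Context {R : realType}.
Implicit Types (y : R -> R) (F : R[i] -> R[i]) (s : R[i]).

Definition laplace_integrand y s : R -> R[i] :=
  fun t => cexp (- s * t%:C) * (y t)%:C.

Definition laplace_integrable y s : Prop :=
  (@lebesgue_measure R).-integrable `]0%R, +oo[
    (EFin \o (fun t => complex.Re (laplace_integrand y s t))) /\
  (@lebesgue_measure R).-integrable `]0%R, +oo[
    (EFin \o (fun t => complex.Im (laplace_integrand y s t))).

Definition laplace y s : R[i] :=
  (\int[@lebesgue_measure R]_(t in `]0%R, +oo[)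
     complex.Re (laplace_integrand y s t))
  +i*
  (\int[@lebesgue_measure R]_(t in `]0%R, +oo[)
     complex.Im (laplace_integrand y s t)).

(* A Laplace transform determines its original only almost everywhere, so the
   original is normalised to be continuous on t > 0, where it is then unique.
   As usual, the transform is only required to be F on some right half-plane. *)
Definition is_inverse_laplace F y : Prop :=
  {in `]0%R, +oo[, continuous y} /\
  exists c : R, forall s, c < complex.Re s ->
    laplace_integrable y s /\ laplace y s = F s.

(* Meaningful only for t > 0, and only when F has a continuous original. *)
Definition inverse_laplace F : R -> R :=
  xget (fun=> 0) [set y | is_inverse_laplace F y].

End LaplaceTransform.

Section Density.
Context {R : realType}.

Definition Rfun (mu nu a t : R) : R :=
  inverse_laplace (fun s => cpow s (- mu) * cexp (- a%:C * cpow s nu)) t.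

Definition pfun (kappa nu x t : R) : R :=
  (2 * Num.sqrt kappa)^-1 * Rfun (1 - nu) nu (`|x| / Num.sqrt kappa) t.

(* f is a probability density function of the real random variable X; having
   one is what makes X a continuous random variable. *)
Definition is_pdf (d : measure_display) (T : measurableType d)
    (P : probability T R) (X : {RV P >-> R}) (f : R -> R) : Prop :=
  [/\ measurable_fun [set: R] f,
      forall x, 0 <= f x &
      forall A : set R, measurable A ->
        distribution P X A = (\int[lebesgue_measure]_(x in A) (f x)%:E)%E].

End Density.

(* Main.v *)
Require Import Defs.
From HB Require Import structures.
From mathcomp Require Import all_boot all_order all_algebra.
From mathcomp Require Import complex.
From mathcomp Require Import all_classical all_reals all_analysis.
From mathcomp Require Import measurable_realfun.
From mathcomp Require Import ring lra.

Set Implicit Arguments.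
Unset Strict Implicit.
Unset Printing Implicit Defensive.

Import Order.TTheory GRing.Theory Num.Theory.
Import numFieldNormedType.Exports.

Local Open Scope classical_set_scope.
Local Open Scope ring_scope.

(* For nu <= 1/2 the real part of s ^ nu is nonnegative on the plane cut along
   the negative axis, so that w ^ (nu - 1) * exp (- a w ^ nu) is the integral of
   its jump across the cut against 1 / (w + r). With r = exp x, the cut plane
   becomes the strip |Im| <= pi and this is one shift of contour, from Im = - pi
   to Im = pi. Since 1 / (w + r) is the Laplace transform of exp (- r t), the
   original is an explicit superposition of the functions exp (- r t).
   Its sign is not visible in that formula. It follows from Bernstein's theorem,
   used here only through the moments of the density in the variable exp (- t):
   s ^ (nu - 1) is a mixture of the 1 / (s + r), s ^ nu is a limit of
   W - H with W constant and H such a mixture, and positivity in the sense of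
   Hausdorff is preserved by products and limits, hence by exp (a H).
   By self-similarity p (x, t) = k / 2 * N (k |x|), so the mass does not depend on
   t or kappa; for kappa = 1, averaging over t against exp (- t) turns p into the
   Laplace density exp (- |x|) / 2, whose mass is 1. For nu = 1/2, N is a Gaussian Fourier
   integral that solves N' a = - a / 2 * N a. *)

Section ComplexCalculus.
Local Open Scope complex_scope.
Context {R : realType}.
Implicit Types (z w : R[i]) (x : R).

Local Notation Re := (@complex.Re R).
Local Notation Im := (@complex.Im R).

Lemma ReD z w : Re (z + w) = Re z + Re w. Proof. by case: z; case: w. Qed.
Lemma ImD z w : Im (z + w) = Im z + Im w. Proof. by case: z; case: w. Qed.
Lemma ReN z : Re (- z) = - Re z. Proof. by case: z. Qed.
Lemma ImN z : Im (- z) = - Im z. Proof. by case: z. Qed.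
Lemma ReM z w : Re (z * w) = Re z * Re w - Im z * Im w.
Proof. by case: z; case: w. Qed.
Lemma ImM z w : Im (z * w) = Re z * Im w + Im z * Re w.
Proof. by case: z => a b; case: w => c d; rewrite /= addrC. Qed.
Lemma ReV z : Re z^-1 = Re z / (Re z ^+ 2 + Im z ^+ 2).
Proof. by case: z. Qed.
Lemma ImV z : Im z^-1 = - (Im z / (Re z ^+ 2 + Im z ^+ 2)).
Proof. by case: z. Qed.

Lemma complex_eqP z w : Re z = Re w -> Im z = Im w -> z = w.
Proof. by case: z => a b; case: w => c d /= -> ->. Qed.

Definition ReImE := (ReD, ImD, ReN, ImN, ReM, ImM).

Lemma cmodE z : cmod z = ComplexField.Normc.normc z. Proof. by case: z. Qed.

Lemma cmod_ge0 z : 0 <= cmod z. Proof. exact: sqrtr_ge0. Qed.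

Lemma cmodM z w : cmod (z * w) = cmod z * cmod w.
Proof. by rewrite !cmodE ComplexField.Normc.normcM. Qed.

Lemma cmodV z : cmod z^-1 = (cmod z)^-1.
Proof. by rewrite !cmodE ComplexField.Normc.normcV. Qed.

Lemma cmodN z : cmod (- z) = cmod z.
Proof. by rewrite /cmod ReN ImN !sqrrN. Qed.

Lemma cmodB_sym z w : cmod (z - w) = cmod (w - z).
Proof. by rewrite -cmodN opprB. Qed.

Lemma cmodD z w : cmod (z + w) <= cmod z + cmod w.
Proof. by rewrite !cmodE le_normcD. Qed.

Lemma cmod_real x : cmod x%:C = `|x|.
Proof. by rewrite /cmod /= expr0n addr0 sqrtr_sqr. Qed.

Lemma cmod_eq0 z : (cmod z == 0) = (z == 0).
Proof.
rewrite cmodE; apply/eqP/eqP => [/ComplexField.Normc.eq0_normc//|->].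
exact: ComplexField.Normc.normc0.
Qed.

Lemma cmod_gt0 z : (0 < cmod z) = (z != 0).
Proof. by rewrite lt_neqAle cmod_ge0 andbT eq_sym cmod_eq0. Qed.

Lemma normRe_le_cmod z : `|Re z| <= cmod z.
Proof.
rewrite -(sqrtr_sqr (Re z)) ler_sqrt ?addr_ge0 ?sqr_ge0//.
by rewrite lerDl sqr_ge0.
Qed.

Lemma normIm_le_cmod z : `|Im z| <= cmod z.
Proof.
rewrite -(sqrtr_sqr (Im z)) ler_sqrt ?addr_ge0 ?sqr_ge0//.
by rewrite lerDr sqr_ge0.
Qed.

Lemma sqr_cmod z : cmod z ^+ 2 = Re z ^+ 2 + Im z ^+ 2.
Proof. by rewrite sqr_sqrtr// addr_ge0 ?sqr_ge0. Qed.

Lemma Re_cexp z : Re (cexp z) = expR (Re z) * cos (Im z).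
Proof. by rewrite /cexp ReM /= mul0r subr0. Qed.

Lemma Im_cexp z : Im (cexp z) = expR (Re z) * sin (Im z).
Proof. by rewrite /cexp ImM /= mul0r addr0. Qed.

Definition cRI := (Re_cexp, Im_cexp, ReD, ImD, ReN, ImN, ReM, ImM).

Lemma cexpD z w : cexp (z + w) = cexp z * cexp w.
Proof.
by apply: complex_eqP; rewrite !cRI expRD (cosD, sinD); ring.
Qed.

Lemma cexp_real x : cexp x%:C = (expR x)%:C.
Proof. by apply: complex_eqP; rewrite ?Re_cexp ?Im_cexp /= ?cos0 ?sin0 ?mulr1 ?mulr0. Qed.

Lemma cexp0 : cexp 0 = 1 :> R[i].
Proof. by rewrite (cexp_real 0) expR0. Qed.

Lemma cmod_cexp z : cmod (cexp z) = expR (Re z).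
Proof.
apply/eqP; rewrite -(@eqrXn2 _ 2)// ?cmod_ge0 ?expR_ge0//.
by rewrite sqr_cmod Re_cexp Im_cexp !exprMn -mulrDr cos2Dsin2 mulr1.
Qed.

Lemma cexp_neq0 z : cexp z != 0.
Proof. by rewrite -cmod_eq0 cmod_cexp gt_eqF// expR_gt0. Qed.

Lemma cexpN z : cexp (- z) = (cexp z)^-1.
Proof.
apply: (mulfI (cexp_neq0 z)); rewrite -cexpD subrr cexp0 divff//.
exact: cexp_neq0.
Qed.

Lemma cexpB z w : cexp (z - w) = cexp z / cexp w.
Proof. by rewrite cexpD cexpN. Qed.

Definition is_cderive (f : R -> R[i]) x (d : R[i]) : Prop :=
  is_derive x (1 : R) (Re \o f) (Re d) /\ is_derive x (1 : R) (Im \o f) (Im d).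

Lemma is_cderive_eq f x d d' : is_cderive f x d -> d = d' -> is_cderive f x d'.
Proof. by move=> ? <-. Qed.

Lemma is_cderive_cst c x : is_cderive (fun=> c) x 0.
Proof. by split; exact: is_derive_cst. Qed.

Lemma is_cderiveD f g x d e : is_cderive f x d -> is_cderive g x e ->
  is_cderive (fun y => f y + g y) x (d + e).
Proof.
move=> [f1 f2] [g1 g2]; split; rewrite ReImE.
- rewrite (_ : _ \o _ = (Re \o f) + (Re \o g)); first exact: is_deriveD.
  by apply/funext => y /=; rewrite ReD.
- rewrite (_ : _ \o _ = (Im \o f) + (Im \o g)); first exact: is_deriveD.
  by apply/funext => y /=; rewrite ImD.
Qed.

Lemma is_cderiveM f g x d e : is_cderive f x d -> is_cderive g x e ->
  is_cderive (fun y => f y * g y) x (f x * e + d * g x).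
Proof.
move=> [f1 f2] [g1 g2]; split; rewrite !ReImE.
- rewrite (_ : _ \o _ = (Re \o f) * (Re \o g) - (Im \o f) * (Im \o g)).
    by apply: is_derive_eq; rewrite /GRing.scale/=; ring.
  by apply/funext => y /=; rewrite ReM.
- rewrite (_ : _ \o _ = (Re \o f) * (Im \o g) + (Im \o f) * (Re \o g)).
    by apply: is_derive_eq; rewrite /GRing.scale/=; ring.
  by apply/funext => y /=; rewrite ImM.
Qed.

Lemma is_cderive_cexp f x d : is_cderive f x d ->
  is_cderive (fun y => cexp (f y)) x (d * cexp (f x)).
Proof.
move=> [f1 f2]; split; rewrite !cRI.
- rewrite (_ : _ \o _ = (expR \o (Re \o f)) * (cos \o (Im \o f))).
    by apply: is_derive_eq; rewrite /GRing.scale/=; ring.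
  by apply/funext => y; exact: Re_cexp.
- rewrite (_ : _ \o _ = (expR \o (Re \o f)) * (sin \o (Im \o f))).
    by apply: is_derive_eq; rewrite /GRing.scale/=; ring.
  by apply/funext => y; exact: Im_cexp.
Qed.

End ComplexCalculus.

Lemma MVT_closed (R : realType) (f df : R -> R) (a b : R) : a <= b ->
  (forall x, a <= x <= b -> is_derive x 1 f (df x)) ->
  exists2 c, a <= c <= b & f b - f a = df c * (b - a).
Proof.
move=> ab fdf.
have [||c] := @MVT_segment R f df a b ab.
- by move=> x xab; apply: fdf; rewrite !ltW ?(itvP xab).
- apply: derivable_within_continuous => x xab.
  by have [] := fdf x _; rewrite ?(itvP xab).
by rewrite in_itv/= => cab fE; exists c.
Qed.

Section ComplexFunctionsOfRealVariable.
Local Open Scope complex_scope.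
Context {R : realType}.
Implicit Types (z w c : R[i]) (x : R).

Local Notation Re := (@complex.Re R).
Local Notation Im := (@complex.Im R).

Lemma is_cderive_of_real x : is_cderive (fun y => y%:C) x 1.
Proof. by split; [exact: is_derive_id|exact: is_derive_cst]. Qed.

Lemma is_cderiveV f x d : f x != 0 -> is_cderive f x d ->
  is_cderive (fun y => (f y)^-1) x (- d / f x ^+ 2).
Proof.
move=> fx0 [f1 f2].
pose n2 := (Re \o f) * (Re \o f) + (Im \o f) * (Im \o f).
have n2E y : n2 y = Re (f y) ^+ 2 + Im (f y) ^+ 2 by [].
have n20 : Re (f x) ^+ 2 + Im (f x) ^+ 2 != 0.
  by rewrite -sqr_cmod sqrf_eq0 cmod_eq0.
have dn2 : is_derive x 1 n2 _ := is_deriveD (is_deriveM f1 f1) (is_deriveM f2 f2).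
pose q := (f x)^-1.
have dE : - d / f x ^+ 2 = - d * (q * q) by rewrite -invfM -expr2.
have n2V := is_deriveV (n20 : n2 x != 0) dn2.
split.
- rewrite (_ : _ \o _ = (Re \o f) * (fun y => (n2 y)^-1)); last first.
    by apply/funext => y; rewrite /= ReV -n2E.
  apply: (is_derive_eq (is_deriveM f1 n2V)); rewrite /GRing.scale/= n2E.
  by rewrite dE !(ReN, ImN, ReM, ImM) /q ReV ImV; field.
- rewrite (_ : _ \o _ = - ((Im \o f) * (fun y => (n2 y)^-1))); last first.
    by apply/funext => y; rewrite /= ImV -n2E.
  apply: (is_derive_eq (is_deriveN (is_deriveM f2 n2V))); rewrite /GRing.scale/= n2E.
  by rewrite dE !(ReN, ImN, ReM, ImM) /q ReV ImV; field.
Qed.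

Lemma cmod_conjc z : cmod (conjc z) = cmod z.
Proof. by case: z => a b; rewrite /cmod /= sqrrN. Qed.

(* The mean value theorem is applied to the component along cexp z - cexp w. *)
Lemma cmod_cexpB z w (m : R) : Re z <= m -> Re w <= m ->
  cmod (cexp z - cexp w) <= expR m * cmod (z - w).
Proof.
move=> zm wm; set D := cexp z - cexp w.
have [->|D0] := eqVneq (cmod D) 0; first by rewrite mulr_ge0 ?expR_ge0 ?cmod_ge0.
have Dgt0 : 0 < cmod D by rewrite lt_neqAle eq_sym D0 cmod_ge0.
pose g t := conjc D * cexp (w + t%:C * (z - w)).
have dg t : is_cderive g t (conjc D * ((z - w) * cexp (w + t%:C * (z - w)))).
  apply: is_cderive_eq.
    apply: is_cderiveM; first exact: is_cderive_cst.
    apply: is_cderive_cexp; apply: is_cderiveD; first exact: is_cderive_cst.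
    by apply: is_cderiveM; [exact: is_cderive_of_real|exact: is_cderive_cst].
  by rewrite /=; ring.
have [t t01] := @MVT_closed R _ _ 0 1 ler01 (fun t _ => (dg t).1).
rewrite subr0 mulr1 (_ : _ - _ = Re (g 1 - g 0)); last by rewrite ReD ReN.
rewrite /g mul1r mul0r addr0 addrCA subrr addr0 -mulrBr.
rewrite -/D (_ : Re (conjc D * D) = cmod D ^+ 2); last first.
  by rewrite sqr_cmod; case: D {D0 Dgt0 g dg} => a b /=; ring.
move=> E; rewrite -(ler_pM2l Dgt0) -expr2 E.
apply: (le_trans (ler_norm _)); apply: (le_trans (normRe_le_cmod _)).
rewrite !(cmod_cexp, cmodM) cmod_conjc ler_wpM2l ?cmod_ge0//.
rewrite mulrC ler_wpM2r ?cmod_ge0// ler_expR ReD ReM /= mul0r subr0 ReD ReN.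
by case/andP: t01 => t0 t1; nra.
Qed.

Definition ccontinuous_at {T : topologicalType} (f : T -> R[i]) (p : T) :=
  {for p, continuous (Re \o f)} /\ {for p, continuous (Im \o f)}.

Section Continuity.
Context {T : topologicalType}.
Implicit Types (f g : T -> R[i]) (p : T).

Lemma ccontinuous_cst c p : ccontinuous_at (fun=> c) p.
Proof. by split; exact: cst_continuous. Qed.

Lemma ccontinuous_of_real (f : T -> R) p :
  {for p, continuous f} -> ccontinuous_at (fun q => (f q)%:C) p.
Proof. by move=> fp; split => //; exact: cst_continuous. Qed.

Lemma ccontinuous_pair (f g : T -> R) p : {for p, continuous f} ->
  {for p, continuous g} -> ccontinuous_at (fun q => f q +i* g q) p.
Proof. by []. Qed.

Lemma ccontinuousD f g p : ccontinuous_at f p -> ccontinuous_at g p ->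
  ccontinuous_at (fun q => f q + g q) p.
Proof.
move=> [f1 f2] [g1 g2]; split.
- rewrite (_ : _ \o _ = (Re \o f) \+ (Re \o g)); first exact: continuousD.
  by apply/funext => q; exact: ReD.
- rewrite (_ : _ \o _ = (Im \o f) \+ (Im \o g)); first exact: continuousD.
  by apply/funext => q; exact: ImD.
Qed.

Lemma ccontinuousM f g p : ccontinuous_at f p -> ccontinuous_at g p ->
  ccontinuous_at (fun q => f q * g q) p.
Proof.
move=> [f1 f2] [g1 g2]; split.
- rewrite (_ : _ \o _ = (fun q => Re (f q) * Re (g q) - Im (f q) * Im (g q))).
    by apply: continuousB; exact: continuousM.
  by apply/funext => q; exact: ReM.
- rewrite (_ : _ \o _ = (fun q => Re (f q) * Im (g q) + Im (f q) * Re (g q))).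
    by apply: continuousD; exact: continuousM.
  by apply/funext => q; exact: ImM.
Qed.

Lemma ccontinuous_sqr_cmod f p : ccontinuous_at f p ->
  {for p, continuous (fun q => Re (f q) ^+ 2 + Im (f q) ^+ 2)}.
Proof.
move=> [f1 f2]; rewrite /prop_for/continuous_at.
under eq_fun do rewrite !expr2.
by rewrite !expr2; apply: cvgD; apply: cvgM.
Qed.

Lemma ccontinuousV f p : f p != 0 -> ccontinuous_at f p ->
  ccontinuous_at (fun q => (f q)^-1) p.
Proof.
move=> fp0 cf; have n2 := ccontinuous_sqr_cmod cf; move: cf => [f1 f2].
have n20 : Re (f p) ^+ 2 + Im (f p) ^+ 2 != 0.
  by rewrite -sqr_cmod sqrf_eq0 cmod_eq0.
split.
- rewrite (_ : _ \o _ = (fun q => Re (f q) * (Re (f q) ^+ 2 + Im (f q) ^+ 2)^-1)).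
    by apply: continuousM => //; exact: continuousV.
  by apply/funext => q; exact: ReV.
- rewrite (_ : _ \o _ = (fun q => - (Im (f q) * (Re (f q) ^+ 2 + Im (f q) ^+ 2)^-1))).
    by apply: continuousN; apply: continuousM => //; exact: continuousV.
  by apply/funext => q; exact: ImV.
Qed.

Lemma ccontinuous_cexp f p : ccontinuous_at f p ->
  ccontinuous_at (fun q => cexp (f q)) p.
Proof.
move=> [f1 f2]; split.
- rewrite (_ : _ \o _ = (fun q => expR (Re (f q)) * cos (Im (f q)))).
    apply: (@continuousM _ _ (expR \o (Re \o f)) (cos \o (Im \o f))).
      by apply: continuous_comp => //; exact: continuous_expR.
    by apply: continuous_comp => //; exact: continuous_cos.
  by apply/funext => q; exact: Re_cexp.
- rewrite (_ : _ \o _ = (fun q => expR (Re (f q)) * sin (Im (f q)))).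
    apply: (@continuousM _ _ (expR \o (Re \o f)) (sin \o (Im \o f))).
      by apply: continuous_comp => //; exact: continuous_expR.
    by apply: continuous_comp => //; exact: continuous_sin.
  by apply/funext => q; exact: Im_cexp.
Qed.

End Continuity.

Lemma is_cderive_continuous f x d : is_cderive f x d -> ccontinuous_at f x.
Proof.
move=> [[f1 _] [f2 _]].
by split; apply: differentiable_continuous; apply/derivable1_diffP.
Qed.

(* Complex differentiability of f at x + i y, expressed by the derivatives
   along the two axes. *)
Definition is_holo (f : R -> R -> R[i]) (x y : R) (d : R[i]) : Prop :=
  is_cderive (f ^~ y) x d /\ is_cderive (f x) y ('i * d).

Lemma is_holo_cst c x y : is_holo (fun _ _ => c) x y 0.
Proof. by split; rewrite ?mulr0; exact: is_cderive_cst. Qed.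

Lemma is_holo_id x y : is_holo (fun a b => a +i* b) x y 1.
Proof.
split; split; rewrite /= ?mul0r ?mul1r ?mulr0 ?mulr1 ?subr0 ?addr0 ?add0r.
- exact: is_derive_id.
- exact: is_derive_cst.
- exact: is_derive_cst.
- exact: is_derive_id.
Qed.

Lemma is_holoD f g x y d e : is_holo f x y d -> is_holo g x y e ->
  is_holo (fun a b => f a b + g a b) x y (d + e).
Proof.
by move=> [f1 f2] [g1 g2]; split; rewrite ?mulrDr; exact: is_cderiveD.
Qed.

Lemma is_holoM f g x y d e : is_holo f x y d -> is_holo g x y e ->
  is_holo (fun a b => f a b * g a b) x y (f x y * e + d * g x y).
Proof.
move=> [f1 f2] [g1 g2]; split; first exact: is_cderiveM.
by apply: is_cderive_eq; [exact: (is_cderiveM f2 g2)|rewrite /=; ring].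
Qed.

Lemma is_holoV f x y d : f x y != 0 -> is_holo f x y d ->
  is_holo (fun a b => (f a b)^-1) x y (- d / f x y ^+ 2).
Proof.
move=> f0 [f1 f2]; split; first exact: is_cderiveV.
by apply: is_cderive_eq; [exact: (is_cderiveV f0 f2)|rewrite /=; ring].
Qed.

Lemma is_holo_cexp f x y d : is_holo f x y d ->
  is_holo (fun a b => cexp (f a b)) x y (d * cexp (f x y)).
Proof.
move=> [f1 f2]; split; first exact: is_cderive_cexp.
by apply: is_cderive_eq; [exact: (is_cderive_cexp f2)|rewrite /=; ring].
Qed.

End ComplexFunctionsOfRealVariable.

Section IntegralLemmas.
Context {R : realType}.
Local Notation mu := (@lebesgue_measure R).
Implicit Types (f g K : R -> R) (D : set R).

Lemma integrable_dominated D f K : measurable D -> measurable_fun D f ->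
  (forall x, D x -> `|f x| <= K x) -> mu.-integrable D (EFin \o K) ->
  mu.-integrable D (EFin \o f).
Proof.
move=> mD mf fK iK.
apply: (@le_integrable _ _ _ mu D mD _ (EFin \o K)) => //.
  exact/measurable_EFinP.
move=> x Dx /=; rewrite lee_fin; apply: (le_trans (fK _ Dx)); exact: ler_norm.
Qed.

Lemma RintegrableZ D f (k : R) : measurable D -> mu.-integrable D (EFin \o f) ->
  mu.-integrable D (EFin \o (fun x => k * f x)).
Proof. by move=> mD intf; exact: (@integrableZl _ _ _ mu D mD k (EFin \o f)). Qed.

Lemma RintegrableD D f g : measurable D -> mu.-integrable D (EFin \o f) ->
  mu.-integrable D (EFin \o g) -> mu.-integrable D (EFin \o (fun x => f x + g x)).
Proof.
move=> mD intf intg.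
exact: (@integrableD _ _ _ mu D mD (EFin \o f) (EFin \o g) intf intg).
Qed.

Lemma RintegrableB D f g : measurable D -> mu.-integrable D (EFin \o f) ->
  mu.-integrable D (EFin \o g) -> mu.-integrable D (EFin \o (fun x => f x - g x)).
Proof.
move=> mD intf intg.
exact: (@integrableB _ _ _ mu D mD (EFin \o f) (EFin \o g) intf intg).
Qed.

Lemma continuous_integrable_dominated f K : continuous f ->
  (forall x, `|f x| <= K x) -> mu.-integrable setT (EFin \o K) ->
  mu.-integrable setT (EFin \o f).
Proof.
move=> cf fK; apply: integrable_dominated => //.
exact: continuous_measurable_fun.
Qed.

Lemma cvg_Rintegral_dominated D (f_ : nat -> R -> R) f K : measurable D ->
  (forall n, measurable_fun D (f_ n)) ->
  (forall x, D x -> f_ n x @[n --> \oo] --> f x) ->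
  (forall n x, D x -> `|f_ n x| <= K x) -> mu.-integrable D (EFin \o K) ->
  \int[mu]_(x in D) f_ n x @[n --> \oo] --> \int[mu]_(x in D) f x.
Proof.
move=> mD mf ff fK iK.
have mflim : measurable_fun D f by apply: measurable_fun_cvg mf ff.
have fKlim x : D x -> `|f x| <= K x.
  move=> Dx; have cn : `|f_ n x| @[n --> \oo] --> `|f x|.
    by apply: cvg_norm; exact: ff.
  rewrite -(cvg_lim _ cn)//; apply: limr_le; first by apply/cvg_ex; exists `|f x|.
  by apply: nearW => n; exact: fK.
have iflim := integrable_dominated mD mflim fKlim iK.
apply: fine_cvg; rewrite fineK; last exact: integrable_fin_num.
apply: (@dominated_cvg _ _ _ mu D mD (fun n x => (f_ n x)%:E) _ (EFin \o K)) => //.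
- by move=> n; apply/measurable_EFinP; exact: mf.
- by move=> x Dx; apply: cvg_EFin; [exact: nearW|exact: ff].
Qed.

Lemma cvg_Rintegral_symitv f : mu.-integrable setT (EFin \o f) ->
  \int[mu]_(x in `[- n%:R, n%:R]) f x @[n --> \oo] --> \int[mu]_x f x.
Proof.
move=> intf; have /measurable_int/measurable_EFinP mf := intf.
under eq_fun do rewrite Rintegral_mkcond.
apply: (@cvg_Rintegral_dominated _ _ _ (fun x => `|f x|)) => //.
- move=> n; apply/(measurable_restrictT _ _).1 => //.
  exact: measurable_funS mf.
- move=> x _; apply: cvg_near_cst; near=> n.
  rewrite patchE ifT// inE/= in_itv/= -ler_norml.
  by near: n; exact: nbhs_infty_ger.
- move=> n x _; rewrite patchE; case: ifPn => // _; by rewrite normr0.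
- exact: integrable_norm.
Unshelve. all: end_near. Qed.

Lemma rectangle_bounded (e : R * R -> R) (a b c d : R) :
  (forall x y, a <= x <= b -> c <= y <= d -> {for (x, y), continuous e}) ->
  exists2 M, 0 < M & forall x y, a <= x <= b -> c <= y <= d -> `|e (x, y)| <= M.
Proof.
move=> ce; have cA : compact (`[a, b] `*` `[c, d] : set (R * R)).
  by apply: compact_setX; exact: segment_compact.
have /compact_bounded[M [Mr HM]] : compact (e @` (`[a, b] `*` `[c, d])).
  apply: continuous_compact => //.
  apply: continuous_in_subspaceT => -[x y].
  by rewrite inE/= !in_itv/= => -[]; exact: ce.
exists (`|M| + 1); first by rewrite ltr_wpDl.
move=> x y xab ycd; apply: (HM (`|M| + 1)).
  by rewrite (le_lt_trans (ler_norm _))// ltrDl.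
by exists (x, y) => //; rewrite /= !in_itv/=.
Qed.

Lemma derivable_continuous f x : derivable f x 1 -> {for x, continuous f}.
Proof. by move=> /derivable1_diffP/differentiable_continuous. Qed.

Lemma continuous_pairl (e : R * R -> R) x y :
  {for (x, y), continuous e} -> {for x, continuous (fun z => e (z, y))}.
Proof.
move=> ce; apply: (@continuous_comp _ _ _ (fun z : R => (z, y)) e) => //.
by apply: (@cvg_pair _ _ _ _ (nbhs x) (nbhs y)) => //; exact: cvg_cst.
Qed.

(* Cauchy's theorem for rectangles, for one component of the function: f and g
   are a pair of components linked by the Cauchy-Riemann equations. *)
Lemma strip_shift_component (f g e : R -> R -> R) (u v a b : R) K :
  u < a -> a <= b -> b < v ->
  (forall x y, u <= y <= v -> is_derive y (1 : R) (f x : R -> R) (e x y)) ->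
  (forall x y, u <= y <= v -> is_derive x (1 : R) (g ^~ y : R -> R) (e x y)) ->
  (forall x y, u <= y <= v -> {for (x, y), continuous (fun p => e p.1 p.2)}) ->
  (forall x y, u <= y <= v -> {for x, continuous (f ^~ y)}) ->
  (forall x y, a <= y <= b -> `|f x y| <= K x) ->
  (forall x y, a <= y <= b -> `|g x y| <= K x) ->
  mu.-integrable setT (EFin \o K) ->
  K n%:R @[n --> \oo] --> (0 : R) -> K (- n%:R) @[n --> \oo] --> (0 : R) ->
  \int[mu]_x f x a = \int[mu]_x f x b.
Proof.
move=> ua ab bv df dg ce cf fK gK iK Kn KNn.
pose G n y := \int[mu]_(x in `[- n%:R, n%:R]) f x y.
have inS y : a <= y <= b -> u <= y <= v.
  by case/andP => ay yb; rewrite (le_trans (ltW ua))//= (le_trans yb)// ltW.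
have cfx y : u <= y <= v -> continuous (f ^~ y) by move=> uyv x; exact: cf.
have dG n y : a <= y <= b -> is_derive y (1 : R) (G n.+1)
    (g n.+1%:R y - g (- n.+1%:R) y).
  move=> yab; set N : R := n.+1%:R; have N0 : - N < N by rewrite gtrN// ltr0n.
  have [M M0 eM] : exists2 M, 0 < M & forall x y, - N <= x <= N ->
      u <= y <= v -> `|e x y| <= M.
    have [|M M0 HM] := @rectangle_bounded (fun p => e p.1 p.2) (- N) N u v.
      by move=> x z _; exact: ce.
    by exists M.
  have yuv : y \in `]u, v[%R.
    by case/andP: yab => ay yb; rewrite in_itv/= (lt_le_trans ua)//= (le_lt_trans yb).
  have IS z : `]u, v[%classic z -> u <= z <= v.
    by rewrite /= in_itv/= => /andP[/ltW-> /ltW->].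
  have mB : measurable (`[- N, N]%classic : set R) by [].
  have intf z : `]u, v[%classic z ->
      mu.-integrable `[- N, N] (EFin \o (fun x => f x z)).
    move=> /IS zuv; apply: continuous_compact_integrable.
      exact: segment_compact.
    by apply: continuous_subspaceT; exact: cfx.
  have der z x : `]u, v[%classic z -> `[- N, N]%classic x ->
      derivable ((fun z x => f x z) ^~ x) z 1.
    by move=> /IS zuv _; have [] := df x z zuv.
  have intM : mu.-integrable `[- N, N] (EFin \o cst M).
    apply: continuous_compact_integrable; first exact: segment_compact.
    by apply: continuous_subspaceT => ?; exact: cst_continuous.
  have d1 z x : u <= z <= v -> partial1of2 (fun z x => f x z) z x = e x z.
    by move=> zuv; rewrite partial1of2E; have [] := df x z zuv.
  have d1M z x : `]u, v[%classic z -> `[- N, N]%classic x ->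
      `|partial1of2 (fun z x => f x z) z x| <= M.
    move=> /IS zuv; rewrite /= in_itv/= => xN.
    by rewrite d1//; apply: eM.
  have M0' (x : R) : 0 <= cst M x by exact: ltW.
  have I1 := @derivable_under_integral R _ _ mu (fun z x => f x z) _ mB y u v
    yuv intf der (cst M) M0' intM d1M.
  have I2 := @differentiation_under_integral R _ _ mu (fun z x => f x z) _ mB y u v
    yuv intf der (cst M) M0' intM d1M.
  apply: DeriveDef; first exact: I1.
  rewrite -derive1E [LHS]I2 /=.
  transitivity (\int[mu]_(x in `[- N, N]) e x y).
    by apply: eq_Rintegral => x _; rewrite d1// inS.
  rewrite /Rintegral (@continuous_FTC2 _ (e ^~ y) (g ^~ y))//.
  - apply: continuous_subspaceT => x.
    by have := continuous_pairl (ce x y (inS _ yab)).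
  - have dgy x : derivable (g ^~ y) x 1 by have [] := dg x y (inS _ yab).
    have cgy x : {for x, continuous (g ^~ y)}.
      exact: (derivable_continuous (dgy x)).
    split; first by move=> x _; exact: dgy.
      by apply: cvg_at_right_filter; exact: cgy.
    by apply: cvg_at_left_filter; exact: cgy.
  - by move=> x _; rewrite derive1E; have [] := dg x y (inS _ yab).
have cvgG y : a <= y <= b -> G n.+1 y @[n --> \oo] --> \int[mu]_x f x y.
  move=> yab; rewrite (cvg_shiftS (fun n => G n y)).
  apply: cvg_Rintegral_symitv; apply: continuous_integrable_dominated iK.
    exact/cfx/inS.
  by move=> x; exact: fK.
have aab : a <= a <= b by rewrite lexx.
have bab : a <= b <= b by rewrite lexx ab.
have dlim : G n.+1 b - G n.+1 a @[n --> \oo] --> \int[mu]_x f x b - \int[mu]_x f x a.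
  exact: cvgB (cvgG _ bab) (cvgG _ aab).
have dlim0 : G n.+1 b - G n.+1 a @[n --> \oo] --> (0 : R).
  have bnd : (K n.+1%:R + K (- n.+1%:R)) * (b - a) @[n --> \oo] --> (0 : R).
    have K1 : K n.+1%:R @[n --> \oo] --> (0 : R).
      by rewrite (cvg_shiftS (fun n => K n%:R)).
    have K2 : K (- n.+1%:R) @[n --> \oo] --> (0 : R).
      by rewrite (cvg_shiftS (fun n => K (- n%:R))).
    have K12 : K n.+1%:R + K (- n.+1%:R) @[n --> \oo] --> (0 : R).
      by rewrite -[X in _ --> X]addr0; exact: cvgD K1 K2.
    by rewrite -(mul0r (b - a)); exact: cvgMl.
  apply/norm_cvg0P; apply: squeeze_cvgr (cvg_cst 0) bnd.
  apply: nearW => n; rewrite normr_ge0 /=.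
  have [c cab ->] := MVT_closed ab (dG n).
  rewrite normrM (ger0_norm (_ : 0 <= b - a)) ?subr_ge0//.
  rewrite ler_wpM2r ?subr_ge0// (le_trans (ler_normB _ _))// lerD//; exact: gK.
apply/esym/subr0_eq.
by rewrite -(cvg_lim (@Rhausdorff R) dlim) (cvg_lim (@Rhausdorff R) dlim0).
Qed.

Lemma ge0_integral_affine (k c : R) (G : R -> R) : 0 < k -> continuous G ->
  (forall x, 0 <= G x) ->
  (\int[mu]_x (G x)%:E = \int[mu]_x (G (k * x + c) * k)%:E)%E.
Proof.
move=> k0 cG G0; pose F (x : R) := k * x + c.
have dF (x : R) : is_derive x (1 : R) F k.
  rewrite /F; apply: is_derive_eq; rewrite addr0 /GRing.scale/=; ring.
have F'E : (F^`())%classic = cst k.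
  by apply/funext => x; rewrite derive1E; have [] := dF x.
rewrite (@increasing_ge0_integration_by_substitutionT _ F G)//.
- by apply: eq_integral => x _; rewrite F'E.
- by move=> x y xy; rewrite /F ltrD2r ltr_pM2l.
- by rewrite F'E => x; exact: cst_continuous.
- by rewrite F'E; exact: is_cvg_cst.
- by rewrite F'E; exact: is_cvg_cst.
- apply/cvgrNyPle => A; near=> x.
  rewrite /F -lerBrDr mulrC -ler_pdivlMr; last exact: k0.
  by near: x; apply: nbhs_ninfty_le; exact: num_real.
- apply/cvgryPge => A; near=> x.
  rewrite /F -lerBlDr mulrC -ler_pdivrMr; last exact: k0.
  by near: x; apply: nbhs_pinfty_ge; exact: num_real.
Unshelve. all: end_near. Qed.

Lemma integrable_shift f (c : R) : continuous f ->
  mu.-integrable setT (EFin \o f) ->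
  mu.-integrable setT (EFin \o (fun x => f (x + c))) /\
  \int[mu]_x f (x + c) = \int[mu]_x f x.
Proof.
move=> cf intf.
have cfc : continuous (fun x => f (x + c)).
  move=> x; apply: (@continuous_comp _ _ _ (fun z : R => z + c)); last exact: cf.
  by apply: cvgD; [exact: cvg_id|exact: cvg_cst].
have shift (G : R -> R) : continuous G -> (forall x, 0 <= G x) ->
    (\int[mu]_x (G (x + c))%:E = \int[mu]_x (G x)%:E)%E.
  move=> cG G0; rewrite (@ge0_integral_affine 1 c G)//.
  by apply: eq_integral => x _; rewrite mul1r mulr1.
have cn : continuous (fun x => `|f x|).
  by move=> x; apply: cvg_norm; exact: cf.
have nint : mu.-integrable setT (EFin \o (fun x => f (x + c))).
  apply/integrableP; split.
    by apply/measurable_EFinP; exact: continuous_measurable_fun.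
  have /integrableP[_] := intf.
  rewrite -[X in (X < +oo)%E -> _]/((\int[mu]_x (`|f x|)%:E)%E).
  by rewrite -(shift (fun x => `|f x|)).
split => //; rewrite -[LHS]addr0 -[X in _ + X = _](subrr (\int[mu]_x `|f x|)) addrA.
have cn1 : continuous (fun x => f x + `|f x|).
  by move=> x; apply: cvgD; [exact: cf|exact: cn].
have intn := integrable_norm intf.
have intnc := integrable_norm nint.
rewrite -[X in _ + X - _](_ : \int[mu]_x `|f (x + c)| = _); last first.
  by rewrite /Rintegral (shift (fun x => `|f x|)).
rewrite -RintegralD// {1}/Rintegral (shift (fun x => f x + `|f x|))//; last first.
  by move=> x; have := ler_norm (- f x); rewrite normrN; lra.
by rewrite -/(Rintegral _ _ _) RintegralD// addrK.
Qed.

End IntegralLemmas.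

Section ComplexIntegral.
Local Open Scope complex_scope.
Context {R : realType}.
Local Notation mu := (@lebesgue_measure R).
Local Notation Re := (@complex.Re R).
Local Notation Im := (@complex.Im R).
Implicit Types (f g : R -> R[i]) (K : R -> R) (c : R[i]).

Definition cintegrable f : Prop :=
  mu.-integrable setT (EFin \o (Re \o f)) /\
  mu.-integrable setT (EFin \o (Im \o f)).

Definition cint f : R[i] :=
  (\int[mu]_x Re (f x)) +i* (\int[mu]_x Im (f x)).

Lemma cintegrable_dominated f K : (forall x, ccontinuous_at f x) ->
  (forall x, cmod (f x) <= K x) -> mu.-integrable setT (EFin \o K) ->
  cintegrable f.
Proof.
move=> cf fK iK; split; apply: continuous_integrable_dominated iK.
- by move=> x; have [] := cf x.
- by move=> x; rewrite (le_trans (normRe_le_cmod _)).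
- by move=> x; have [] := cf x.
- by move=> x; rewrite (le_trans (normIm_le_cmod _)).
Qed.

Lemma cintD f g : cintegrable f -> cintegrable g ->
  cint (fun x => f x + g x) = cint f + cint g.
Proof.
move=> [f1 f2] [g1 g2]; apply: complex_eqP; rewrite ?ReD ?ImD /= -RintegralD//.
- by apply: eq_Rintegral => x _; rewrite ReD.
- by apply: eq_Rintegral => x _; rewrite ImD.
Qed.

Lemma cintegrableMl c f : cintegrable f -> cintegrable (fun x => c * f x).
Proof.
move=> [f1 f2].
split.
- rewrite (_ : _ \o _ = (fun x => Re c * Re (f x) - Im c * Im (f x))).
    by apply: RintegrableB => //; exact: RintegrableZ.
  by apply/funext => x; rewrite /= ReM.
- rewrite (_ : _ \o _ = (fun x => Re c * Im (f x) + Im c * Re (f x))).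
    by apply: RintegrableD => //; exact: RintegrableZ.
  by apply/funext => x; rewrite /= ImM.
Qed.

Lemma cintMl c f : cintegrable f -> cint (fun x => c * f x) = c * cint f.
Proof.
move=> [f1 f2].
apply: complex_eqP; rewrite ?ReM ?ImM /= -!RintegralZl//.
- rewrite -RintegralB//; [|exact: RintegrableZ|exact: RintegrableZ].
  by apply: eq_Rintegral => x _; rewrite ReM.
- rewrite -RintegralD//; [|exact: RintegrableZ|exact: RintegrableZ].
  by apply: eq_Rintegral => x _; rewrite ImM.
Qed.

Lemma cint_shift f (a : R) : (forall x, ccontinuous_at f x) -> cintegrable f ->
  cint (fun x => f (x + a)) = cint f.
Proof.
move=> cf [f1 f2]; apply: complex_eqP => /=.
- by have [_ ->] := @integrable_shift R (Re \o f) a (fun x => (cf x).1) f1.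
- by have [_ ->] := @integrable_shift R (Im \o f) a (fun x => (cf x).2) f2.
Qed.

Lemma strip_shift (h d : R -> R -> R[i]) (u v a b : R) K :
  u < a -> a <= b -> b < v ->
  (forall x y, u <= y <= v -> is_holo h x y (d x y)) ->
  (forall x y, u <= y <= v -> ccontinuous_at (fun p => d p.1 p.2) (x, y)) ->
  (forall x y, a <= y <= b -> cmod (h x y) <= K x) ->
  mu.-integrable setT (EFin \o K) ->
  K n%:R @[n --> \oo] --> (0 : R) -> K (- n%:R) @[n --> \oo] --> (0 : R) ->
  cint (h ^~ a) = cint (h ^~ b).
Proof.
move=> ua ab bv dh cd hK iK Kn KNn.
have ch x y : u <= y <= v -> ccontinuous_at (h ^~ y) x.
  by move=> /(dh x)[/is_cderive_continuous].
have hRe x y : a <= y <= b -> `|Re (h x y)| <= K x.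
  by move=> /(hK x); exact: le_trans (normRe_le_cmod _).
have hIm x y : a <= y <= b -> `|Im (h x y)| <= K x.
  by move=> /(hK x); exact: le_trans (normIm_le_cmod _).
apply: complex_eqP => /=.
- apply: (@strip_shift_component R (fun x y => Re (h x y))
    (fun x y => - Im (h x y)) (fun x y => - Im (d x y)) u v a b K) => //.
  + move=> x y /(dh x)[_ [+ _]].
    by rewrite ReM mul0r mul1r sub0r.
  + by move=> x y /(dh x)[[_ +] _]; exact: is_deriveN.
  + by move=> x y /(cd x)[_ ci]; apply: continuousN.
  + by move=> x y /(ch x)[].
  + by move=> x y ayb; rewrite normrN; exact: hIm.
- apply: (@strip_shift_component R (fun x y => Im (h x y))
    (fun x y => Re (h x y)) (fun x y => Re (d x y)) u v a b K) => //.
  + move=> x y /(dh x)[_ [_ +]].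
    by rewrite ImM mul0r mul1r add0r.
  + by move=> x y /(dh x)[[+ _] _].
  + by move=> x y /(cd x)[].
  + by move=> x y /(ch x)[].
Qed.

End ComplexIntegral.

Section HolomorphicStrip.
Local Open Scope complex_scope.
Context {R : realType}.
Local Notation mu := (@lebesgue_measure R).
Local Notation Re := (@complex.Re R).
Local Notation Im := (@complex.Im R).
Variables u v : R.
Implicit Types (f g : R -> R -> R[i]).

Definition holo_strip f := exists d : R -> R -> R[i], forall x y, u <= y <= v ->
  [/\ is_holo f x y (d x y), ccontinuous_at (fun p => f p.1 p.2) (x, y) &
      ccontinuous_at (fun p => d p.1 p.2) (x, y)].

Lemma holo_strip_cst c : holo_strip (fun _ _ => c).
Proof.
exists (fun _ _ => 0) => x y _; split; first exact: is_holo_cst;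
  exact: ccontinuous_cst.
Qed.

Lemma holo_strip_id : holo_strip (fun x y => x +i* y).
Proof.
exists (fun _ _ => 1) => x y _; split; first exact: is_holo_id.
  by apply: ccontinuous_pair; [exact: cvg_fst|exact: cvg_snd].
exact: ccontinuous_cst.
Qed.

Lemma holo_stripD f g : holo_strip f -> holo_strip g ->
  holo_strip (fun x y => f x y + g x y).
Proof.
move=> [d hd] [e he]; exists (fun x y => d x y + e x y) => x y xy.
have [d1 d2 d3] := hd x y xy; have [e1 e2 e3] := he x y xy.
by split; [exact: is_holoD|exact: ccontinuousD|exact: ccontinuousD].
Qed.

Lemma holo_stripM f g : holo_strip f -> holo_strip g ->
  holo_strip (fun x y => f x y * g x y).
Proof.
move=> [d hd] [e he]; exists (fun x y => f x y * e x y + d x y * g x y) => x y xy.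
have [d1 d2 d3] := hd x y xy; have [e1 e2 e3] := he x y xy.
split; [exact: is_holoM|exact: ccontinuousM|].
by apply: ccontinuousD; exact: ccontinuousM.
Qed.

Lemma holo_stripV f : (forall x y, u <= y <= v -> f x y != 0) -> holo_strip f ->
  holo_strip (fun x y => (f x y)^-1).
Proof.
move=> f0 [d hd]; exists (fun x y => - d x y / f x y ^+ 2) => x y xy.
have [d1 d2 d3] := hd x y xy; have fxy := f0 _ _ xy.
split; [exact: is_holoV|exact: ccontinuousV|].
rewrite (_ : (fun p => _) =
    (fun p => -1 * d p.1 p.2 * ((f p.1 p.2)^-1 * (f p.1 p.2)^-1))).
  apply: ccontinuousM; first by apply: ccontinuousM => //; exact: ccontinuous_cst.
  by apply: ccontinuousM; exact: ccontinuousV.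
by apply/funext => p; rewrite mulN1r expr2 invfM.
Qed.

Lemma holo_strip_cexp f : holo_strip f -> holo_strip (fun x y => cexp (f x y)).
Proof.
move=> [d hd]; exists (fun x y => d x y * cexp (f x y)) => x y xy.
have [d1 d2 d3] := hd x y xy.
split; [exact: is_holo_cexp|exact: ccontinuous_cexp|].
by apply: ccontinuousM => //; exact: ccontinuous_cexp.
Qed.

Lemma holo_strip_continuous f x y : holo_strip f -> u <= y <= v ->
  ccontinuous_at (f ^~ y) x /\ ccontinuous_at (f x) y.
Proof.
move=> [d hd] xy; have [[/is_cderive_continuous c1 /is_cderive_continuous c2] _ _] := hd x y xy.
by split.
Qed.

Lemma holo_strip_cint f (a b : R) (K : R -> R) : holo_strip f ->
  u < a -> a <= b -> b < v ->
  (forall x y, a <= y <= b -> cmod (f x y) <= K x) ->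
  mu.-integrable setT (EFin \o K) ->
  K n%:R @[n --> \oo] --> (0 : R) -> K (- n%:R) @[n --> \oo] --> (0 : R) ->
  cint (f ^~ a) = cint (f ^~ b).
Proof.
move=> [d hd] ua ab bv fK iK Kn KNn.
by apply: (@strip_shift R f d u v a b K) => // x y xy; have [] := hd x y xy.
Qed.

End HolomorphicStrip.

Section Kernel.
Context {R : realType}.
Local Notation mu := (@lebesgue_measure R).
Variable nu : R.
Hypotheses (nu_gt0 : 0 < nu) (nu_le : nu <= 2^-1).

Definition stieltjes_kernel (x : R) : R := expR (nu * x) / (1 + expR x).
Local Notation K := stieltjes_kernel.

Lemma onePexp_gt0 (x : R) : 0 < 1 + expR x.
Proof. by rewrite addr_gt0 ?expR_gt0. Qed.

Lemma stieltjes_kernel_gt0 x : 0 < K x.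
Proof. by rewrite divr_gt0 ?expR_gt0 ?onePexp_gt0. Qed.

Lemma stieltjes_kernel_continuous : continuous K.
Proof.
move=> x; apply: cvgM.
  apply: (@continuous_comp _ _ _ (fun y : R => nu * y)); last exact: continuous_expR.
  by apply: cvgM; [exact: cvg_cst|exact: cvg_id].
apply: cvgV; first by rewrite gt_eqF ?onePexp_gt0.
by apply: cvgD; [exact: cvg_cst|exact: continuous_expR].
Qed.

Lemma stieltjes_kernel_le x : K x <= expR (- nu * `|x|).
Proof.
rewrite /K ler_pdivrMr ?onePexp_gt0// mulrDr mulr1 -expRD.
have [x0|x0] := leP 0 x.
  rewrite (ger0_norm x0).
  apply: (@le_trans _ _ (expR (- nu * x + x))); last by rewrite lerDr expR_ge0.
  have nu2 : 0 <= 1 - nu - nu.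
    by rewrite -addrA -opprD subr_ge0 -mulr2n -mulr_natr -ler_pdivlMr// mul1r.
  by have := mulr_ge0 nu2 x0; rewrite ler_expR; lra.
rewrite (ltr0_norm x0); apply: (@le_trans _ _ (expR (- nu * - x))); last by rewrite lerDl expR_ge0.
by rewrite ler_expR; lra.
Qed.

Lemma stieltjes_kernel_integrable : mu.-integrable setT (EFin \o K).
Proof.
apply: (@continuous_integrable_dominated R K (fun x => expR (- nu * `|x|))).
- exact: stieltjes_kernel_continuous.
- by move=> x; rewrite ger0_norm ?stieltjes_kernel_le// ltW// stieltjes_kernel_gt0.
have ce : continuous (fun x : R => expR (- nu * `|x|)).
  move=> x; apply: (@continuous_comp _ _ _ (fun y : R => - nu * `|y|)).
    apply: cvgM; first exact: cvg_cst.
    by apply: cvg_norm; exact: cvg_id.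
  exact: continuous_expR.
apply/integrableP; split.
  by apply/measurable_EFinP; exact: continuous_measurable_fun.
under eq_integral do rewrite /= ger0_norm ?expR_ge0//.
rewrite ge0_symfun_integralT//; last by move=> x /=; rewrite normrN.
rewrite lte_mul_pinfty//.
have mnn : measurable [set x : R | 0 <= x] by rewrite -set_itvcy.
have : mu.-integrable [set x | 0 <= x] (EFin \o (fun x => nu^-1 * exponential_pdf nu x)).
  apply: RintegrableZ => //; apply: (integrableS measurableT) => //.
  exact: integrable_exponential_pdf.
move/integrable_lty => /(_ mnn); congr (_ < _)%E.
apply: eq_integral => x; rewrite inE/= => x0.
rewrite exponential_pdfE// ger0_norm// mulrA mulVf ?mul1r//.
exact: lt0r_neq0.
Qed.

Lemma cvg_stieltjes_kernel : K n%:R @[n --> \oo] --> (0 : R) /\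
  K (- n%:R) @[n --> \oo] --> (0 : R).
Proof.
have ge : expR (- nu) ^+ n @[n --> \oo] --> (0 : R).
  apply: cvg_expr; rewrite ger0_norm ?expR_ge0// expRN invf_lt1 ?expR_gt0//.
  by rewrite expR_gt1.
have le (x : R) n : `|x| = n%:R -> 0 <= K x <= expR (- nu) ^+ n.
  move=> xn; rewrite ltW ?stieltjes_kernel_gt0//= (le_trans (stieltjes_kernel_le _))//.
  by rewrite xn -expRM_natr.
split; apply: squeeze_cvgr (cvg_cst 0) ge; apply: nearW => n; apply: le.
- by rewrite ger0_norm.
- by rewrite normrN ger0_norm.
Qed.

End Kernel.

Section TrigonometricBounds.
Local Open Scope complex_scope.
Context {R : realType}.

Lemma cos_lt1 (t : R) : 0 < `|t| < pi *+ 2 -> cos t < 1.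
Proof.
rewrite -(cos_norm t) => /andP[t0 t2]; set v := `|t| / 2.
have tE : `|t| = v *+ 2 by rewrite mulr2n -splitr.
have sv : 0 < sin v.
  apply: sin_gt0_pi; rewrite divr_gt0//=.
  by rewrite ltr_pdivrMr// mulr_natr.
rewrite tE cos_mulr2n.
have := cos2Dsin2 v; have : 0 < sin v ^+ 2 by rewrite exprn_gt0.
by rewrite mulr2n => *; lra.
Qed.

Lemma sin_ge_linear (t : R) : 0 <= t <= pi / 2 + pi / 4 ->
  cos (pi / 4) / 4 * t <= sin t.
Proof.
move=> /andP[t0 t1].
have pi0 := pi_gt0 R; have pi4 : pi < 4 :> R.
  by have := pihalf_lt2 R; rewrite ltr_pdivrMr// -natrM.
have c4 : 0 < cos (pi / 4 : R) by apply: cos_gt0_pihalf; apply/andP; split; lra.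
have [t4|t4] := leP t (pi / 4).
  have [c /andP[c0 ct]] : exists2 c, 0 <= c <= t & sin t - sin 0 = cos c * (t - 0).
    by apply: MVT_closed => // x _; exact: is_derive_sin.
  rewrite sin0 !subr0 => ->; rewrite ler_wpM2r//.
  have : cos (pi / 4) <= cos c.
    have [->//|cn] := eqVneq c (pi / 4).
    rewrite ltW// ltr_cos ?in_itv/= ?c0 ?divr_ge0 ?pi_ge0//=; last 2 first.
    - lra.
    - lra.
    by rewrite lt_neqAle cn (le_trans ct).
  by lra.
apply: (@le_trans _ _ (cos (pi / 4))); first by nra.
rewrite -(cosBpihalf t) -(cos_norm (t - pi / 2)).
have n4 : `|t - pi / 2| <= pi / 4 by rewrite ler_norml; apply/andP; split; lra.
have [->//|cn] := eqVneq `|t - pi / 2| (pi / 4).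
rewrite ltW// ltr_cos ?in_itv/= ?normr_ge0 ?divr_ge0 ?pi_ge0//=; last 2 first.
- lra.
- lra.
by rewrite lt_neqAle cn.
Qed.

Lemma cos_le_quadratic (t : R) : `|t| <= pi + pi / 2 ->
  (cos (pi / 4)) ^+ 2 / 32 * t ^+ 2 <= 1 - cos t.
Proof.
suff H (s : R) : 0 <= s -> s <= pi + pi / 2 ->
    (cos (pi / 4)) ^+ 2 / 32 * s ^+ 2 <= 1 - cos s.
  by move=> /(H _ (normr_ge0 t)); rewrite real_normK ?num_real// cos_norm.
move=> s0 s1; have [v sE] : exists v, s = v *+ 2.
  by exists (s / 2); rewrite mulr2n -splitr.
have v0 : 0 <= v <= pi / 2 + pi / 4.
  by move: s0 s1; rewrite sE mulr2n => *; apply/andP; split; lra.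
have := sin_ge_linear v0; case/andP: v0 => v0 _.
have c4 : 0 < cos (pi / 4 : R).
  by have pi0 := pi_gt0 R; apply: cos_gt0_pihalf; apply/andP; split; lra.
move=> sv; have : (cos (pi / 4) / 4 * v) ^+ 2 <= sin v ^+ 2.
  by rewrite lerXn2r// nnegrE ?(le_trans _ sv)// mulr_ge0// divr_ge0// ltW.
rewrite sE cos_mulr2n; have := cos2Dsin2 v.
by rewrite !exprMn !mulr2n exprVn => *; lra.
Qed.

Lemma expR_sub1_ge (x : R) : `|x| <= 1 -> expR (-1) * `|x| <= `|expR x - 1|.
Proof.
move=> x1; have e1 : expR (-1) <= 1 :> R by rewrite ltW// expR_lt1 oppr_lt0.
have e0 := expR_gt0 (-1 : R).
have [x0|x0] := leP 0 x.
  rewrite (ger0_norm x0) (@le_trans _ _ x)//; first by rewrite ler_piMl.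
  by rewrite (le_trans _ (ler_norm _))// lerBrDr addrC expR_ge1Dx.
rewrite (ltr0_norm x0) ltr0_norm; last by rewrite subr_lt0 expR_lt1.
have := expR_ge1Dx (- x); rewrite expRN => xe.
have ex0 := expR_gt0 x.
have : expR (-1) <= expR x.
  by rewrite ler_expR; move: x1; rewrite (ltr0_norm x0); lra.
move=> ee; rewrite opprB.
have : (1 - x) * expR x <= 1 by rewrite -ler_pdivlMr// mul1r.
by nra.
Qed.

Lemma cexp_sub1_ge : exists2 c : R, 0 < c & forall x y : R, `|x| <= 1 ->
  `|y| <= pi + pi / 2 -> c * cmod (x +i* y) <= cmod (cexp (x +i* y) - 1).
Proof.
have c4 : 0 < cos (pi / 4 : R).
  by have pi0 := pi_gt0 R; apply: cos_gt0_pihalf; apply/andP; split; lra.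
set k := cos (pi / 4) in c4.
pose c2 : R := Num.min (expR (-1) ^+ 2) (expR (-1) * (k ^+ 2 / 16)).
have e1 := expR_gt0 (-1 : R).
have c20 : 0 < c2.
  by rewrite /c2 lt_min exprn_gt0//= mulr_gt0// divr_gt0// exprn_gt0.
exists (Num.sqrt c2); first by rewrite sqrtr_gt0.
move=> x y x1 y1.
rewrite -(@ler_pXn2r _ 2)// ?nnegrE ?cmod_ge0 ?mulr_ge0 ?cmod_ge0 ?sqrtr_ge0//.
rewrite exprMn sqr_sqrtr ?(ltW c20)// !sqr_cmod ReD ImD Re_cexp Im_cexp /= oppr0 addr0.
have -> : (expR x * cos y - 1) ^+ 2 + (expR x * sin y) ^+ 2 =
    (expR x - 1) ^+ 2 + 2 * expR x * (1 - cos y).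
  by rewrite [(expR x * sin y) ^+ 2]exprMn sin2cos2; ring.
have h1 : c2 * x ^+ 2 <= (expR x - 1) ^+ 2.
  apply: (@le_trans _ _ (expR (-1) ^+ 2 * x ^+ 2)).
    by rewrite ler_wpM2r ?sqr_ge0// ge_min lexx.
  rewrite -exprMn -(real_normK (num_real (_ * x))) -(real_normK (num_real (_ - 1))).
  by rewrite lerXn2r ?nnegrE// normrM (gtr0_norm e1) expR_sub1_ge.
have h2 : c2 * y ^+ 2 <= 2 * expR x * (1 - cos y).
  apply: (@le_trans _ _ (expR (-1) * (k ^+ 2 / 16) * y ^+ 2)).
    by rewrite ler_wpM2r ?sqr_ge0// ge_min lexx orbT.
  have ex : expR (-1) <= expR x by rewrite ler_expR; move: x1; rewrite ler_norml => /andP[].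
  have := cos_le_quadratic y1; rewrite -/k => ck.
  have ky : 0 <= k ^+ 2 / 32 * y ^+ 2.
    by rewrite mulr_ge0 ?sqr_ge0// divr_ge0// sqr_ge0.
  have -> : expR (-1) * (k ^+ 2 / 16) * y ^+ 2 = 2 * expR (-1) * (k ^+ 2 / 32 * y ^+ 2) by field.
  by apply: ler_pM => //; rewrite ler_pM2l.
by rewrite mulrDr lerD.
Qed.

Lemma expR_sub_ge (x0 : R) : exists2 c : R, 0 < c & forall x : R,
  1 <= `|x - x0| -> c * (1 + expR x) <= `|expR x - expR x0|.
Proof.
set F := expR x0; have F0 : 0 < F by exact: expR_gt0.
have e0 := expR_gt0 (-1 : R).
have e1 : expR (-1) < 1 :> R by rewrite expR_lt1 oppr_lt0.
pose d : R := 1 - expR (-1); have d0 : 0 < d by rewrite subr_gt0.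
have d1 : d = 1 - expR (-1) by [].
pose c : R := d * Num.min 1 F / 2.
have c1 : c <= d / 2.
  by rewrite ler_pM2r// ler_piMr//; [exact: ltW|rewrite ge_min lexx].
have c2 : c <= d * F / 2.
  by rewrite ler_pM2r// ler_pM2l// ge_min lexx orbT.
have c0 : 0 < c by rewrite divr_gt0// mulr_gt0// lt_min ltr01.
exists c => // x; set E := expR x; have E0 : 0 < E by exact: expR_gt0.
have [xx|xx] := leP x0 x.
- rewrite ger0_norm ?subr_ge0// => h1.
  have FE : F <= expR (-1) * E by rewrite -expRD ler_expR; lra.
  rewrite ger0_norm; last by rewrite subr_ge0 ler_expR.
  by nra.
- rewrite ltr0_norm ?subr_lt0// => h1.
  have EF : E <= expR (-1) * F by rewrite -expRD ler_expR; lra.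
  rewrite ltr0_norm; last by rewrite subr_lt0 ltr_expR.
  by nra.
Qed.

End TrigonometricBounds.

Section Contour.
Local Open Scope complex_scope.
Context {R : realType}.
Local Notation mu := (@lebesgue_measure R).
Local Notation Re := (@complex.Re R).
Local Notation Im := (@complex.Im R).
Variable nu : R.
Hypotheses (nu_gt0 : 0 < nu) (nu_le : nu <= 2^-1).
Local Notation K := (stieltjes_kernel nu).

Lemma ccontinuous_comp (s : R -> R) (f : R -> R[i]) (x : R) :
  {for x, continuous s} -> ccontinuous_at f (s x) ->
  ccontinuous_at (fun z => f (s z)) x.
Proof.
move=> cs [f1 f2]; split; first exact: (@continuous_comp _ _ _ s (Re \o f)).
exact: (@continuous_comp _ _ _ s (Im \o f)).
Qed.

Lemma cint_real (f : R -> R) : cint (fun x => (f x)%:C) = (\int[mu]_x f x)%:C.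
Proof.
by apply: complex_eqP => //=; rewrite Rintegral_cst// mul0r.
Qed.

Lemma cexp_pair (x y : R) : cexp (x +i* y) = (expR x)%:C * (cos y +i* sin y).
Proof. by []. Qed.

Lemma real_mul_pair (b x y : R) : b%:C * (x +i* y) = (b * x) +i* (b * y).
Proof. by apply: complex_eqP; rewrite !cRI /= mul0r ?subr0 ?addr0. Qed.

Lemma cmod_expD1_ge (x y : R) : 0 <= cos y ->
  (1 + expR x) / 2 <= cmod (cexp (x +i* y) + 1).
Proof.
move=> cy; have ex := expR_gt0 x.
rewrite -(@ler_pXn2r _ 2)// ?nnegrE ?cmod_ge0 ?divr_ge0 ?ltW ?onePexp_gt0//.
rewrite sqr_cmod ReD ImD Re_cexp Im_cexp /= addr0 [(expR x * sin y) ^+ 2]exprMn sin2cos2.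
have := mulr_ge0 (ltW ex) cy.
by rewrite expr_div_n; nra.
Qed.

Definition stieltjes_const : R := \int[mu]_x K x.

Lemma stieltjes_const_gt0 : 0 < stieltjes_const.
Proof.
have iK := stieltjes_kernel_integrable nu_gt0 nu_le.
have Kc := stieltjes_kernel_continuous (nu := nu).
have K01 : exists2 m : R, 0 < m & forall x, 0 <= x <= 1 -> m <= K x.
  exists (1 + expR 1)^-1; first by rewrite invr_gt0 onePexp_gt0.
  move=> x /andP[x0 x1]; rewrite -[leLHS]mul1r; apply: ler_pM => //.
  - by rewrite -expR0 ler_expR mulr_ge0// ltW.
  by rewrite lef_pV2 ?posrE ?onePexp_gt0// lerD2l ler_expR.
have [m m0 mK] := K01.
apply: (@lt_le_trans _ _ (\int[mu]_(x in `[0, 1]) m)).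
  rewrite Rintegral_cst//= lebesgue_measure_itv/= lte_fin ltr01 /= oppr0 addr0 mulr1.
  exact: m0.
rewrite Rintegral_mkcond /stieltjes_const; apply: le_Rintegral => //.
  have : mu.-integrable `[0, 1] (EFin \o cst m).
    apply: continuous_compact_integrable; first exact: segment_compact.
    by apply: continuous_subspaceT => ?; exact: cst_continuous.
  by move/(integrable_mkcond _ _).1; rewrite restrict_EFin; exact.
move=> x _; rewrite patchE; case: ifPn => [|_]; last exact/ltW/stieltjes_kernel_gt0.
by rewrite inE/= in_itv/= => /mK.
Qed.

Lemma stieltjes_power (x0 phi : R) : `|phi| < pi / 2 ->
  cint (fun x => (expR (nu * x))%:C / (cexp (x0 +i* phi) + (expR x)%:C)) =
  stieltjes_const%:C * cexp ((nu - 1)%:C * (x0 +i* phi)).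
Proof.
move=> phi2; have pi0 := pi_gt0 R.
have [Kn KNn] := cvg_stieltjes_kernel nu_gt0 nu_le.
have iK := stieltjes_kernel_integrable nu_gt0 nu_le.
pose h (x y : R) : R[i] := cexp (nu%:C * (x +i* y)) * (cexp (x +i* y) + 1)^-1.
have cosy (y : R) : - (pi / 2) <= y <= pi / 2 -> 0 <= cos y by exact: cos_ge0_pihalf.
have den0 (x y : R) : - (pi / 2) <= y <= pi / 2 -> cexp (x +i* y) + 1 != 0.
  move=> /cosy/(cmod_expD1_ge x) le; by rewrite -cmod_gt0 (lt_le_trans _ le).
have hh : holo_strip (- (pi / 2)) (pi / 2) h.
  apply: holo_stripM.
    apply: holo_strip_cexp; apply: holo_stripM; last exact: holo_strip_id.
    exact: holo_strip_cst.
  apply: holo_stripV => //; apply: holo_stripD; last exact: holo_strip_cst.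
  by apply: holo_strip_cexp; exact: holo_strip_id.
have hK (x y : R) : - (pi / 2) <= y <= pi / 2 -> cmod (h x y) <= 2 * K x.
  move=> /cosy/(cmod_expD1_ge x) le.
  rewrite cmodM cmodV cmod_cexp real_mul_pair /=.
  rewrite /stieltjes_kernel mulrCA ler_wpM2l ?expR_ge0//.
  have e2 : 0 < (1 + expR x) / 2 by [].
  by rewrite -[X in X / _]invrK -invfM mulrC lef_pV2 ?posrE// (lt_le_trans e2 le).
have i2K : mu.-integrable setT (EFin \o (fun x => 2 * K x)) by exact: RintegrableZ.
have K2n : 2 * K n%:R @[n --> \oo] --> (0 : R).
  by rewrite -(mulr0 (2 : R)); apply: cvgMr.
have K2Nn : 2 * K (- n%:R) @[n --> \oo] --> (0 : R).
  by rewrite -(mulr0 (2 : R)); apply: cvgMr.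
have phi1 : - (pi / 2) <= - phi <= pi / 2.
  by move: phi2; rewrite ltr_norml => /andP[? ?]; apply/andP; split; lra.
have E : cint (h ^~ (- phi)) = cint (h ^~ 0).
  move: phi2; rewrite ltr_norml => /andP[? ?].
  have [p0|p0] := leP (- phi) 0.
    apply: (holo_strip_cint hh _ p0 _ _ i2K K2n K2Nn); [lra|lra|].
    by move=> x y /andP[? ?]; apply: hK; apply/andP; split; lra.
  apply/esym.
  apply: (holo_strip_cint hh _ (ltW p0) _ _ i2K K2n K2Nn); [lra|lra|].
  by move=> x y /andP[? ?]; apply: hK; apply/andP; split; lra.
have h0 : cint (h ^~ 0) = stieltjes_const%:C.
  have h0x x : h x 0 = (K x)%:C.
    rewrite /h real_mul_pair mulr0 !(cexp_real) -(rmorphD (real_complex R) _ 1).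
    by rewrite -fmorphV -rmorphM [in RHS]/stieltjes_kernel addrC.
  by rewrite (funext h0x) cint_real.
have hc x : ccontinuous_at (h ^~ (- phi)) x.
  by have [] := holo_strip_continuous x hh phi1.
have hint : cintegrable (h ^~ (- phi)).
  by apply: (cintegrable_dominated hc _ i2K) => x; exact: hK.
rewrite -h0 -E -(cint_shift (- x0) hc hint) mulrC.
rewrite -cintMl; last first.
  apply: (@cintegrable_dominated _ _ (fun x => 2 * K (x - x0))).
  - move=> x; have sx : {for x, continuous (fun z : R => z - x0)}.
      by apply: cvgB; [exact: cvg_id|exact: cvg_cst].
    exact: (ccontinuous_comp sx (hc _)).
  - by move=> x; exact: hK.
  - have k2c : continuous (fun x => 2 * K x).
      by move=> x; apply: cvgM; [exact: cvg_cst|exact: stieltjes_kernel_continuous].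
    by have [] := @integrable_shift _ (fun x => 2 * K x) (- x0) k2c i2K.
congr cint; apply/funext => x; rewrite /h.
set w0 := x0 +i* phi.
have -> : (x - x0) +i* (- phi) = x%:C - w0.
  by apply: complex_eqP; rewrite !cRI//= sub0r.
have e0 := cexp_neq0 w0.
have d0 : cexp w0 + (expR x)%:C != 0.
  have := den0 (x - x0) (- phi) phi1; apply: contraNneq => d0.
  rewrite (_ : (x - x0) +i* (- phi) = x%:C - w0); last first.
    by apply: complex_eqP; rewrite !cRI//= sub0r.
  rewrite cexpB cexp_real -(mulfK e0 1) mul1r -mulrDl -[X in _ + X]mul1r.
  by rewrite addrC mul1r d0 mul0r.
rewrite mulrBr cexpB rmorphB /= mulrBl mul1r !cexpB -rmorphM /= !cexp_real.
have en0 := cexp_neq0 (nu%:C * w0).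
have -> : (expR x)%:C / cexp w0 + 1 = (cexp w0 + (expR x)%:C) / cexp w0.
  by rewrite mulrDl divff// addrC.
by field; rewrite e0 en0 d0.
Qed.

End Contour.

Section ContourShift.
Local Open Scope complex_scope.
Context {R : realType}.
Local Notation mu := (@lebesgue_measure R).
Local Notation Re := (@complex.Re R).
Local Notation Im := (@complex.Im R).
Variable nu : R.
Hypotheses (nu_gt0 : 0 < nu) (nu_le : nu <= 2^-1).
Local Notation K := (stieltjes_kernel nu).
Variables (a x0 phi : R).
Hypotheses (a_ge0 : 0 <= a) (phi_lt : `|phi| < pi / 2).

Local Notation w0 := (x0 +i* phi).

(* The residue at w0 is subtracted, so q extends analytically across w0; the
   value of q at w0 itself is 0 because of the convention 0^-1 = 0. *)
Definition contour_num (x y : R) : R[i] :=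
  cexp (- a%:C * cexp (nu%:C * (x +i* y))) - cexp (- a%:C * cexp (nu%:C * w0)).
Local Notation num := contour_num.

Definition contour_fun (x y : R) : R[i] :=
  cexp (nu%:C * (x +i* y)) * (num x y * (cexp (x +i* y) - cexp w0)^-1).

Local Notation q := contour_fun.

Lemma cexp_pair_eq (x y x' y' : R) : `|y - y'| < pi *+ 2 ->
  cexp (x +i* y) = cexp (x' +i* y') -> x = x' /\ y = y'.
Proof.
move=> yy E.
have e1 : cexp ((x - x') +i* (y - y')) = 1.
  rewrite (_ : _ +i* _ = (x +i* y) - (x' +i* y')); last exact: complex_eqP.
  by rewrite cexpB E divff// cexp_neq0.
have ex : expR (x - x') = 1.
  have := congr1 cmod e1; rewrite cmod_cexp /= => ->.
  by rewrite (cmod_real 1) normr1.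
have xx : x = x' by apply/subr0_eq/expR_inj; rewrite ex expR0.
split => //; apply/eqP; rewrite -subr_eq0; apply/negPn/negP => yy0.
have := congr1 Re e1; rewrite Re_cexp [Re (_ +i* _)]/= ex mul1r [Im _]/= => c1.
have : cos (y - y') < 1 by apply: cos_lt1; rewrite normr_gt0 yy0.
by rewrite c1 ltxx.
Qed.

Lemma contour_nupi (y : R) : `|y| <= pi -> `|nu * y| <= pi / 2.
Proof.
move=> yp; rewrite normrM (gtr0_norm nu_gt0) mulrC.
by apply: ler_pM => //; exact: ltW.
Qed.

Lemma contour_Re_exp_le0 (x y : R) : `|y| <= pi ->
  Re (- a%:C * cexp (nu%:C * (x +i* y))) <= 0.
Proof.
move=> /contour_nupi; rewrite ler_norml => yp.
rewrite real_mul_pair !cRI /= oppr0 mul0r subr0 mulNr oppr_le0.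
by rewrite mulr_ge0// mulr_ge0 ?expR_ge0// cos_ge0_pihalf.
Qed.

Lemma contour_phi_lepi : `|phi| <= pi.
Proof.
by apply: (le_trans (ltW phi_lt)); rewrite ler_pdivrMr// ler_peMr ?pi_ge0// ler1n.
Qed.

Lemma contour_num_le2 (x y : R) : `|y| <= pi -> cmod (num x y) <= 2.
Proof.
move=> yp; apply: (le_trans (cmodD _ _)); rewrite cmodN !cmod_cexp.
rewrite -[leRHS]/(1 + 1).
by apply: lerD; rewrite expR_le1 contour_Re_exp_le0//; exact: contour_phi_lepi.
Qed.

Lemma contour_num_lip (x y : R) : `|y| <= pi -> `|x - x0| <= 1 ->
  cmod (num x y) <= a * nu * expR (nu * (x0 + 1)) * cmod ((x - x0) +i* (y - phi)).
Proof.
move=> yp xx.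
apply: (le_trans (cmod_cexpB (contour_Re_exp_le0 x yp) (contour_Re_exp_le0 x0 contour_phi_lepi))).
rewrite expR0 mul1r -mulrBr cmodM cmodN cmod_real ger0_norm// -!mulrA.
rewrite ler_wpM2l//.
apply: (le_trans (@cmod_cexpB _ _ _ (nu * (x0 + 1)) _ _)).
- rewrite real_mul_pair /= ler_pM2l//.
  by move: xx; rewrite ler_norml => /andP[_]; rewrite lerBlDr addrC.
- by rewrite real_mul_pair /= ler_pM2l// lerDl.
rewrite -mulrBr cmodM cmod_real (gtr0_norm nu_gt0) mulrCA.
by rewrite (_ : (x +i* y) - w0 = (x - x0) +i* (y - phi)) //; exact: complex_eqP.
Qed.

Lemma contour_bound : exists2 B : R, 0 < B &
  forall x y : R, `|y| <= pi -> cmod (q x y) <= B * K x.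
Proof.
have pi0 := pi_gt0 R.
have [c c0 hc] := @expR_sub_ge R x0; have [k k0 hk] := @cexp_sub1_ge R.
pose L := a * nu * expR (nu * (x0 + 1)).
have L0 : 0 <= L by rewrite !mulr_ge0 ?expR_ge0// ltW.
pose B1 : R := L / (expR x0 * k) * (1 + expR (x0 + 1)).
have B10 : 0 <= B1 by rewrite mulr_ge0 ?divr_ge0 ?mulr_ge0 ?expR_ge0// ltW.
have ex := expR_gt0 x0.
exists (2 / c + B1) => [|x y yp]; first by rewrite ltr_wpDr// divr_gt0.
rewrite cmodM cmod_cexp real_mul_pair [Re _]/= /stieltjes_kernel mulrCA.
rewrite ler_wpM2l ?expR_ge0// cmodM cmodV.
have exx := expR_gt0 x.
have e0 : cmod (cexp w0) = expR x0 := cmod_cexp w0.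
have e1 : cmod (cexp (x +i* y)) = expR x := cmod_cexp (x +i* y).
have den : cmod (cexp (x +i* y) - cexp w0) =
    expR x0 * cmod (cexp ((x - x0) +i* (y - phi)) - 1).
  rewrite (_ : (x - x0) +i* (y - phi) = (x +i* y) - w0); last exact: complex_eqP.
  rewrite -e0 -cmodM cexpB.
  by rewrite mulrBr mulr1 mulrC divfK// cexp_neq0.
have [xx|xx] := leP 1 `|x - x0|.
  apply: (@le_trans _ _ (2 / c / (1 + expR x))); last first.
    by rewrite ler_wpM2r ?invr_ge0 ?lerDl// ltW// onePexp_gt0.
  rewrite -mulrA -invfM; apply: ler_pM; rewrite ?cmod_ge0 ?invr_ge0 ?cmod_ge0//.
    exact: contour_num_le2.
  have d : c * (1 + expR x) <= cmod (cexp (x +i* y) - cexp w0).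
    apply: (le_trans (hc x xx)).
    have h1 := cmodD (cexp (x +i* y) - cexp w0) (cexp w0).
    have h2 := cmodD (cexp w0 - cexp (x +i* y)) (cexp (x +i* y)).
    move: h1 h2; rewrite !subrK e0 e1 (cmodB_sym (cexp w0)) => h1 h2.
    by rewrite ler_norml; apply/andP; split; lra.
  have dpos : 0 < c * (1 + expR x) by rewrite mulr_gt0.
  by rewrite lef_pV2// posrE (lt_le_trans dpos).
apply: (@le_trans _ _ (B1 / (1 + expR x))); last first.
  by rewrite ler_wpM2r ?invr_ge0 ?lerDr ?divr_ge0// ltW.
apply: (@le_trans _ _ (L / (expR x0 * k))); last first.
  have Lk : 0 <= L / (expR x0 * k) by rewrite divr_ge0// mulr_ge0// ltW.
  rewrite ler_pdivlMr// /B1 ler_wpM2l// lerD2l ler_expR.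
  by have := ltW xx; rewrite ler_norml => /andP[_]; rewrite lerBlDr addrC.
have y32 : `|y - phi| <= pi + pi / 2.
  by rewrite (le_trans (ler_normB _ _))// lerD// ltW.
have := hk _ _ (ltW xx) y32; have := contour_num_lip yp (ltW xx); rewrite den -/L.
set m := cmod (num x y); set r := cmod (_ +i* _); set d := cmod (_ - 1).
move=> mL kr.
have [d0|d0] := eqVneq d 0.
  by rewrite d0 mulr0 invr0 mulr0 divr_ge0// mulr_ge0// ltW.
have dpos : 0 < d by rewrite lt_neqAle eq_sym d0 cmod_ge0.
rewrite ler_pdivrMr ?mulr_gt0// mulrAC.
rewrite [leRHS](_ : _ = L * (d / k)); last first.
  by field; rewrite !gt_eqF.
by rewrite (le_trans mL)// ler_wpM2l// ler_pdivlMr// mulrC.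
Qed.

Lemma contour_holo (u v : R) : (forall y, u <= y <= v -> y != phi /\ `|y - phi| < pi *+ 2) ->
  holo_strip u v q.
Proof.
move=> uv; have he : holo_strip u v (fun x y => cexp (nu%:C * (x +i* y))).
  apply: holo_strip_cexp; apply: holo_stripM; last exact: holo_strip_id.
  exact: holo_strip_cst.
apply: holo_stripM => //; apply: holo_stripM.
  apply: holo_stripD; last exact: holo_strip_cst.
  apply: holo_strip_cexp; apply: holo_stripM => //; exact: holo_strip_cst.
apply: holo_stripV.
  move=> x y /uv[yp y2]; rewrite subr_eq0; apply/negP => /eqP E.
  by have [_ yE] := cexp_pair_eq y2 E; rewrite yE eqxx in yp.
apply: holo_stripD; last exact: holo_strip_cst.
by apply: holo_strip_cexp; exact: holo_strip_id.
Qed.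

Lemma contour_shift_pole_free (u v b c : R) : u < b -> b <= c -> c < v ->
  (forall y, u <= y <= v -> y != phi /\ `|y - phi| < pi *+ 2) ->
  - pi <= b -> c <= pi -> cint (q ^~ b) = cint (q ^~ c).
Proof.
move=> ub bc cv uv pb cp; have [B B0 qB] := contour_bound.
have [Kn KNn] := cvg_stieltjes_kernel nu_gt0 nu_le.
have iK := stieltjes_kernel_integrable nu_gt0 nu_le.
apply: (@holo_strip_cint R u v q b c (fun x => B * K x)) => //.
- exact: contour_holo.
- move=> x y /andP[b1 b2]; apply: qB.
  by rewrite ler_norml (le_trans pb b1) (le_trans b2 cp).
- exact: RintegrableZ.
- by rewrite -(mulr0 B); apply: cvgMr.
- by rewrite -(mulr0 B); apply: cvgMr.
Qed.

Lemma Rintegral_setC1 (f : R -> R) (x : R) : mu.-integrable setT (EFin \o f) ->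
  \int[mu]_(z in ~` [set x]) f z = \int[mu]_z f z.
Proof.
move=> intf; rewrite /Rintegral; congr fine.
rewrite [RHS](@negligible_integral _ _ _ mu setT [set x])//; first by rewrite setTD.
exact: lebesgue_measure_set1.
Qed.

Lemma contour_holo_near (y : R) : `|y| <= pi -> y != phi -> exists u v,
  [/\ u < y < v & forall z, u <= z <= v -> z != phi /\ `|z - phi| < pi *+ 2].
Proof.
move=> yp yphi; have pi0 := pi_gt0 R.
have d0 : 0 < `|y - phi| by rewrite normr_gt0 subr_eq0.
pose e := Num.min (`|y - phi| / 2) (pi / 4).
have e0 : 0 < e by rewrite lt_min !divr_gt0.
have e1 : e <= `|y - phi| / 2 by rewrite ge_min lexx.
have e2 : e <= pi / 4 by rewrite ge_min lexx orbT.
exists (y - e), (y + e); split; first by rewrite ltrBlDr !ltrDl e0.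
move=> z /andP[z1 z2]; split.
  apply: contraTneq d0 => zE; rewrite -leNgt.
  have : `|y - phi| <= e.
    by rewrite ler_norml; rewrite zE in z1 z2; apply/andP; split; lra.
  by lra.
move: yp phi_lt; rewrite !ltr_norml !ler_norml => /andP[? ?] /andP[? ?].
by rewrite mulr2n; apply/andP; split; lra.
Qed.

Lemma contour_continuous_x (y : R) : `|y| <= pi -> y != phi ->
  forall x, ccontinuous_at (q ^~ y) x.
Proof.
move=> yp yphi x; have [u [v [/andP[uy yv] uv]]] := contour_holo_near yp yphi.
have uyv : u <= y <= v by rewrite !ltW.
by have [] := holo_strip_continuous x (contour_holo uv) uyv.
Qed.

Lemma contour_cintegrable (y : R) : `|y| <= pi -> y != phi -> cintegrable (q ^~ y).
Proof.
move=> yp yphi; have [B B0 qB] := contour_bound.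
apply: (@cintegrable_dominated _ _ (fun x => B * K x)).
- exact: contour_continuous_x.
- by move=> x; exact: qB.
- by apply: RintegrableZ => //; exact: stieltjes_kernel_integrable.
Qed.

Lemma contour_continuous_y (x : R) : x != x0 -> ccontinuous_at (q x) phi.
Proof.
move=> xx.
have ci : ccontinuous_at (fun y : R => x +i* y) phi.
  by apply: ccontinuous_pair; [exact: cst_continuous|exact: cvg_id].
have ce : ccontinuous_at (fun y => cexp (nu%:C * (x +i* y))) phi.
  by apply: ccontinuous_cexp; apply: ccontinuousM => //; exact: ccontinuous_cst.
apply: ccontinuousM => //; apply: ccontinuousM.
  apply: ccontinuousD; last exact: ccontinuous_cst.
  by apply: ccontinuous_cexp; apply: ccontinuousM => //; exact: ccontinuous_cst.
apply: ccontinuousV.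
  rewrite subr_eq0; apply/negP => /eqP E.
  have [|xE _] := cexp_pair_eq _ E; first by rewrite subrr normr0 mulrn_wgt0// pi_gt0.
  by rewrite xE eqxx in xx.
by apply: ccontinuousD; [exact: ccontinuous_cexp|exact: ccontinuous_cst].
Qed.

Lemma contour_limit (y : nat -> R) (g : R[i] -> R) :
  (forall z, `|g z| <= cmod z) ->
  (forall (f : R -> R[i]) z, ccontinuous_at f z -> {for z, continuous (g \o f)}) ->
  (forall f : R -> R[i], cintegrable f -> mu.-integrable setT (EFin \o (g \o f))) ->
  (forall n, `|y n| <= pi) -> (forall n, y n != phi) -> y n @[n --> \oo] --> phi ->
  \int[mu]_x g (q x (y n)) @[n --> \oo] -->
  \int[mu]_(x in ~` [set x0]) g (q x phi).
Proof.
move=> gle gc gi yp yphi yn; have [B B0 qB] := contour_bound.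
have mD : measurable (~` [set x0] : set R) by apply: measurableC.
under eq_fun => n do rewrite -(Rintegral_setC1 x0 (gi _ (contour_cintegrable (yp n) (yphi n)))).
apply: (@cvg_Rintegral_dominated _ _ _ _ (fun x => B * K x)) => //.
- move=> n; apply: measurable_funTS; apply: continuous_measurable_fun => x.
  exact/gc/contour_continuous_x.
- move=> x /eqP xx.
  have := gc _ _ (contour_continuous_y xx) => cq.
  exact: (cvg_comp _ _ yn cq).
- by move=> n x _; rewrite (le_trans (gle _))// qB.
- apply: (integrableS measurableT) => //; apply: RintegrableZ => //.
  exact: stieltjes_kernel_integrable.
Qed.

Lemma contour_shift : cint (q ^~ pi) = cint (q ^~ (- pi)).
Proof.
have pi0 := pi_gt0 R; have pi2 : 1 <= pi / 2 :> R by exact: pihalf_ge1.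
have : - (pi / 2) < phi < pi / 2 by rewrite -ltr_norml.
move=> /andP[phi1 phi2].
pose d n : R := n.+1%:R^-1.
have d0 n : 0 < d n by rewrite invr_gt0 ltr0n.
have d1 n : d n <= 1 by rewrite invf_le1 ?ltr0n// ler1n.
have dn : d n @[n --> \oo] --> (0 : R) by exact: cvg_harmonic.
have up n : cint (q ^~ (phi + d n)) = cint (q ^~ pi).
  have dn0 := d0 n; have dn1 := d1 n.
  apply: (@contour_shift_pole_free (phi + d n / 2) (pi + pi / 4)) => //; try lra.
  move=> y /andP[y1 y2]; split; first by rewrite gt_eqF//; lra.
  by rewrite ltr_norml mulr2n; apply/andP; split; lra.
have dw n : cint (q ^~ (- pi)) = cint (q ^~ (phi - d n)).
  have dn0 := d0 n; have dn1 := d1 n.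
  apply: (@contour_shift_pole_free (- pi - pi / 4) (phi - d n / 2)) => //; try lra.
  move=> y /andP[y1 y2]; split; first by rewrite lt_eqF//; lra.
  by rewrite ltr_norml mulr2n; apply/andP; split; lra.
have upp n : `|phi + d n| <= pi.
  by have dn0 := d0 n; have dn1 := d1 n; rewrite ler_norml; apply/andP; split; lra.
have dwp n : `|phi - d n| <= pi.
  by have dn0 := d0 n; have dn1 := d1 n; rewrite ler_norml; apply/andP; split; lra.
have upn n : phi + d n != phi by rewrite gt_eqF// ltrDl.
have dwn n : phi - d n != phi by rewrite lt_eqF// ltrBlDr ltrDl.
have upc : phi + d n @[n --> \oo] --> phi.
  by rewrite -[X in _ --> X]addr0; apply: cvgD => //; exact: cvg_cst.
have dwc : phi - d n @[n --> \oo] --> phi.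
  by rewrite -[X in _ --> X]subr0; apply: cvgB => //; exact: cvg_cst.
have R1 (f : R -> R[i]) z : ccontinuous_at f z -> {for z, continuous (Re \o f)} by case.
have R2 (f : R -> R[i]) : cintegrable f -> mu.-integrable setT (EFin \o (Re \o f)) by case.
have I1 (f : R -> R[i]) z : ccontinuous_at f z -> {for z, continuous (Im \o f)} by case.
have I2 (f : R -> R[i]) : cintegrable f -> mu.-integrable setT (EFin \o (Im \o f)) by case.
have cst_lim (s : nat -> R) (l m : R) : (forall n, s n = m) ->
    s n @[n --> \oo] --> l -> m = l.
  by move=> sm; rewrite (funext sm) => /(cvg_lim (@Rhausdorff R)) <-; rewrite lim_cst.
apply: complex_eqP.
- rewrite (cst_lim _ _ _ (fun n => congr1 Re (up n))
    (contour_limit (@normRe_le_cmod R) R1 R2 upp upn upc)).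
  by rewrite (cst_lim _ _ _ (fun n => congr1 Re (esym (dw n)))
    (contour_limit (@normRe_le_cmod R) R1 R2 dwp dwn dwc)).
- rewrite (cst_lim _ _ _ (fun n => congr1 Im (up n))
    (contour_limit (@normIm_le_cmod R) I1 I2 upp upn upc)).
  by rewrite (cst_lim _ _ _ (fun n => congr1 Im (esym (dw n)))
    (contour_limit (@normIm_le_cmod R) I1 I2 dwp dwn dwc)).
Qed.

End ContourShift.

Section StieltjesRepresentation.
Local Open Scope complex_scope.
Context {R : realType}.
Local Notation Re := (@complex.Re R).
Local Notation Im := (@complex.Im R).
Variable nu : R.
Hypotheses (nu_gt0 : 0 < nu) (nu_le : nu <= 2^-1).
Local Notation K := (stieltjes_kernel nu).

Lemma cintegrableD (f g : R -> R[i]) : cintegrable f -> cintegrable g ->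
  cintegrable (fun x => f x + g x).
Proof.
move=> [f1 f2] [g1 g2]; split.
- rewrite (_ : _ \o _ = (fun x => Re (f x) + Re (g x))); first exact: RintegrableD.
  by apply/funext => x; rewrite /= ReD.
- rewrite (_ : _ \o _ = (fun x => Im (f x) + Im (g x))); first exact: RintegrableD.
  by apply/funext => x; rewrite /= ImD.
Qed.

Lemma cos_nupi_ge0 : 0 <= cos (nu * pi).
Proof.
have pi0 := pi_gt0 R; apply: cos_ge0_pihalf.
have : nu * pi <= pi / 2 by rewrite mulrC ler_pM2l.
have : 0 < nu * pi by rewrite mulr_gt0.
by move=> ? ?; apply/andP; split; lra.
Qed.

Lemma sin_nupi_gt0 : 0 < sin (nu * pi).
Proof.
have pi0 := pi_gt0 R; apply: sin_gt0_pi; rewrite mulr_gt0//=.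
by rewrite gtr_pMl// (le_lt_trans nu_le)// invf_lt1// ltr1n.
Qed.

(* The imaginary part of omega * exp (- a * exp (nu x) * omega), where omega =
   exp (i pi nu). *)
Definition cut_density (a x : R) : R :=
  expR (- (a * expR (nu * x) * cos (nu * pi))) *
  sin (nu * pi - a * expR (nu * x) * sin (nu * pi)).

Lemma cut_density_le1 (a x : R) : 0 <= a -> `|cut_density a x| <= 1.
Proof.
move=> a0; rewrite normrM ger0_norm ?expR_ge0//.
have s1 : `|sin (nu * pi - a * expR (nu * x) * sin (nu * pi))| <= 1.
  by rewrite ler_norml sin_geN1 sin_le1.
have e1 : expR (- (a * expR (nu * x) * cos (nu * pi))) <= 1.
  by rewrite expR_le1 oppr_le0 !mulr_ge0 ?expR_ge0// cos_nupi_ge0.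
by rewrite -[1]mulr1 ler_pM ?expR_ge0.
Qed.

Lemma cut_density_continuous : continuous (fun p : R * R => cut_density p.1 p.2).
Proof.
move=> p.
have c1 : {for p, continuous (fun p : R * R => p.1 * expR (nu * p.2))}.
  apply: cvgM; first exact: cvg_fst.
  apply: (@continuous_comp _ _ _ (fun p : R * R => nu * p.2)).
    by apply: cvgM; [exact: cvg_cst|exact: cvg_snd].
  exact: continuous_expR.
apply: cvgM.
  apply: (@continuous_comp _ _ _ (fun p : R * R => - (p.1 * expR (nu * p.2) * cos (nu * pi)))).
    by apply: cvgN; apply: cvgM => //; exact: cvg_cst.
  exact: continuous_expR.
apply: (@continuous_comp _ _ _ (fun p : R * R => nu * pi - p.1 * expR (nu * p.2) * sin (nu * pi))).
  apply: cvgB; first exact: cvg_cst.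
  by apply: cvgM => //; exact: cvg_cst.
exact: continuous_sin.
Qed.

Lemma cut_density_continuous_x a : continuous (cut_density a).
Proof.
move=> x.
apply: (@continuous_comp _ _ _ (fun z : R => (a, z)) (fun p : R * R => cut_density p.1 p.2));
  last exact: cut_density_continuous.
by apply: (@cvg_pair _ _ _ _ (nbhs a) (nbhs x)) => //; exact: cvg_cst.
Qed.

Lemma expR_scale_continuous (k : R) : continuous (fun x : R => expR (k * x)).
Proof.
move=> x; apply: (@continuous_comp _ _ _ (fun z : R => k * z)).
  by apply: cvgM; [exact: cvg_cst|exact: cvg_id].
exact: continuous_expR.
Qed.

Lemma cdiv_cintegrable (s : R[i]) (h : R -> R) : 0 < Re s -> continuous h ->
  (forall x, `|h x| <= expR (nu * x)) ->
  cintegrable (fun x => (h x)%:C / (s + (expR x)%:C)).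
Proof.
move=> s0 ch hle; pose m := Num.min 1 (Re s).
have m0 : 0 < m by rewrite lt_min ltr01.
have m1 : m <= 1 by rewrite ge_min lexx.
have ms : m <= Re s by rewrite ge_min lexx orbT.
have den x : m * (1 + expR x) <= cmod (s + (expR x)%:C).
  apply: (le_trans _ (le_trans (ler_norm _) (normRe_le_cmod _))).
  by rewrite ReD /=; have := expR_gt0 x; nra.
have mp x : 0 < m * (1 + expR x) by rewrite mulr_gt0.
apply: (@cintegrable_dominated _ _ (fun x => m^-1 * K x)).
- move=> x; apply: ccontinuousM; first by apply: ccontinuous_of_real; exact: ch.
  apply: ccontinuousV; first by rewrite -cmod_gt0 (lt_le_trans (mp x)).
  apply: ccontinuousD; first exact: ccontinuous_cst.
  by apply: ccontinuous_of_real; exact: continuous_expR.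
- move=> x; rewrite cmodM cmodV cmod_real mulrCA -invfM.
  apply: ler_pM => //; first by rewrite invr_ge0 cmod_ge0.
  by rewrite lef_pV2// posrE (lt_le_trans (mp x)).
- by apply: RintegrableZ => //; exact: stieltjes_kernel_integrable.
Qed.

Lemma stieltjes_representation (a x0 phi : R) : 0 <= a -> `|phi| < pi / 2 ->
  cint (fun x => (expR (nu * x) * cut_density a x)%:C /
    (cexp (x0 +i* phi) + (expR x)%:C)) =
  (stieltjes_const nu * sin (nu * pi))%:C *
  (cexp ((nu - 1)%:C * (x0 +i* phi)) *
   cexp (- a%:C * cexp (nu%:C * (x0 +i* phi)))).
Proof.
move=> a0 phi2; have pi0 := pi_gt0 R.
set w0 := x0 +i* phi; set s := cexp w0.
set E0 := cexp (- a%:C * cexp (nu%:C * w0)).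
have s0 : 0 < Re s.
  rewrite Re_cexp mulr_gt0 ?expR_gt0// cos_gt0_pihalf//.
  by rewrite -ltr_norml.
pose f1 x : R[i] := (expR (nu * x) * cut_density a x)%:C / (s + (expR x)%:C).
pose f2 x : R[i] := (expR (nu * x))%:C / (s + (expR x)%:C).
have cf1 : cintegrable f1.
  apply: cdiv_cintegrable => //.
    by move=> x; apply: cvgM; [exact: expR_scale_continuous|exact: cut_density_continuous_x].
  move=> x; rewrite normrM ger0_norm ?expR_ge0// ler_piMr ?expR_ge0//.
  exact: cut_density_le1.
have cf2 : cintegrable f2.
  apply: cdiv_cintegrable => //; first exact: expR_scale_continuous.
  by move=> x; rewrite ger0_norm ?expR_ge0.
pose q := contour_fun nu a x0 phi.
have piphi : pi != phi.
  by move: phi2; rewrite ltr_norml => /andP[? ?]; rewrite gt_eqF//; lra.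
have cq : cintegrable (q ^~ pi).
  by apply: contour_cintegrable => //; rewrite ger0_norm// ltW.
pose S := sin (nu * pi).
pose J : R[i] := 0 +i* 2.
have qE x : q x (- pi) = q x pi + J * (f1 x + (- (E0 * S%:C)) * f2 x).
  rewrite /q /contour_fun /contour_num -/w0 -/s -/E0 !real_mul_pair !mulrN.
  set e := expR (nu * x).
  have -> : cexp ((nu * x) +i* (nu * pi)) = e%:C * (cos (nu * pi) +i* S) by [].
  have -> : cexp ((nu * x) +i* (- (nu * pi))) = e%:C * (cos (nu * pi) +i* (- S)).
    by rewrite cexp_pair cosN sinN.
  have -> : cexp (x +i* pi) = - (expR x)%:C.
    by rewrite cexp_pair cospi sinpi; apply: complex_eqP; rewrite !cRI /=; ring.
  have -> : cexp (x +i* (- pi)) = - (expR x)%:C.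
    by rewrite cexp_pair cosN sinN cospi sinpi; apply: complex_eqP; rewrite !cRI /=; ring.
  have d0 : s + (expR x)%:C != 0.
    apply/eqP => /(congr1 Re); rewrite ReD /= => /eqP.
    by rewrite gt_eqF// addr_gt0// expR_gt0.
  rewrite -opprD addrC invrN.
  have gE : (cos (nu * pi) +i* S) * cexp (- a%:C * (e%:C * (cos (nu * pi) +i* S))) =
    (cos (nu * pi) +i* (- S)) * cexp (- a%:C * (e%:C * (cos (nu * pi) +i* (- S)))) +
    J * (cut_density a x)%:C.
    have -> : - a%:C * (e%:C * (cos (nu * pi) +i* S)) =
        (- (a * e * cos (nu * pi))) +i* (- (a * e * S)).
      by apply: complex_eqP; rewrite !cRI /=; ring.
    have -> : - a%:C * (e%:C * (cos (nu * pi) +i* (- S))) =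
        (- (a * e * cos (nu * pi))) +i* (a * e * S).
      by apply: complex_eqP; rewrite !cRI /=; ring.
    rewrite !cexp_pair cosN sinN /cut_density -/e sinB -/S.
    by apply: complex_eqP; rewrite !cRI /=; ring.
  rewrite /f1 /f2 -/e.
  have -> : (e * cut_density a x)%:C = e%:C * (cut_density a x)%:C by rewrite rmorphM.
  move: gE; set A := cexp _; set B := cexp _; set G := (cut_density a x)%:C.
  move=> gE.
  have wE : (cos (nu * pi) +i* S) = (cos (nu * pi) +i* (- S)) + J * S%:C.
    by apply: complex_eqP; rewrite !cRI /=; ring.
  rewrite (addrC (expR x)%:C).
  transitivity (- (e%:C * ((cos (nu * pi) +i* (- S)) * B -
    (cos (nu * pi) +i* (- S)) * E0)) / (s + (expR x)%:C)); first by ring.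
  have -> : (cos (nu * pi) +i* (- S)) * B = (cos (nu * pi) +i* S) * A - J * G.
    by rewrite gE; ring.
  have -> : (cos (nu * pi) +i* (- S)) = (cos (nu * pi) +i* S) - J * S%:C.
    by rewrite wE; ring.
  by ring.
have cs := cintegrableMl.
have I : cint (q ^~ (- pi)) = cint (q ^~ pi) +
    J * (cint f1 + - (E0 * S%:C) * cint f2).
  have c2 := cs _ (- (E0 * S%:C)) _ cf2.
  have c12 := cintegrableD cf1 c2.
  rewrite (funext qE) cintD//; last exact: cs.
  by congr (_ + _); rewrite cintMl//; congr (_ * _); rewrite cintD// cintMl.
have := contour_shift nu_gt0 nu_le x0 a0 phi2.
rewrite -/q I => /eqP; rewrite eq_sym -subr_eq0 addrC addKr mulf_eq0 => /orP[|].
  by rewrite eq_complex /= pnatr_eq0 andbF.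
rewrite mulNr subr_eq0 => /eqP ->.
rewrite (stieltjes_power nu_gt0 nu_le x0 phi2) rmorphM /= -/w0 -/E0 -/S.
by ring.
Qed.

End StieltjesRepresentation.

Section HalfLineIntegrals.
Local Open Scope complex_scope.
Context {R : realType}.
Local Notation mu := (@lebesgue_measure R).
Local Notation Re := (@complex.Re R).
Local Notation Im := (@complex.Im R).
Local Notation D := (`]0%R, +oo[%classic : set R).

Lemma RintegrableS (A B : set R) (f : R -> R) : measurable A -> measurable B ->
  B `<=` A -> mu.-integrable A (EFin \o f) -> mu.-integrable B (EFin \o f).
Proof. by move=> mA mB AB; exact: (@integrableS _ _ _ mu A B _ mA mB AB). Qed.

Lemma Rintegrable_patch (A : set R) (f : R -> R) : measurable A ->
  mu.-integrable A (EFin \o f) <-> mu.-integrable setT (EFin \o (f \_ A)).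
Proof.
by move=> mA; rewrite -restrict_EFin; exact: (@integrable_mkcond _ _ _ mu A _ mA).
Qed.

Lemma exponential_integrable (s : R) : 0 < s ->
  mu.-integrable D (EFin \o (fun t => expR (- (s * t)))).
Proof.
move=> s0; have mD : measurable D by [].
have := RintegrableZ s^-1 mD
  (RintegrableS measurableT mD (@subsetT _ D) (integrable_exponential_pdf s0)).
apply: eq_integrable => // t; rewrite inE/= in_itv/= andbT => t0.
rewrite /= exponential_pdfE ?(ltW t0)// mulrA mulVf ?gt_eqF// mul1r mulNr.
by [].
Qed.

Lemma Rintegral_halfline_FTC (f F : R -> R) (l : R) :
  (forall t, is_derive t (1 : R) F (f t)) -> continuous f ->
  mu.-integrable D (EFin \o f) -> F n%:R @[n --> \oo] --> l ->
  \int[mu]_(t in D) f t = l - F 0.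
Proof.
move=> dF cf intf Fl; have mD : measurable D by [].
have intfD : mu.-integrable setT (EFin \o (f \_ D)).
  exact: (Rintegrable_patch f mD).1.
rewrite Rintegral_mkcond; have := cvg_Rintegral_symitv intfD.
rewrite -(cvg_shiftS (fun n : nat => \int[mu]_(x in `[- n%:R, n%:R]) (f \_ D) x)) => lim1.
have FE n : \int[mu]_(x in `[- n.+1%:R, n.+1%:R]) (f \_ D) x = F n.+1%:R - F 0.
  rewrite -Rintegral_mkcondr.
  rewrite (_ : _ `&` _ = `]0, n.+1%:R]%classic); last first.
    apply/seteqP; split => x /=; rewrite !in_itv/= ?andbT.
      by move=> [/andP[_ ->] ->].
    by move=> /andP[x0 xn]; rewrite x0 xn (le_trans _ (ltW x0))// oppr_le0.
  rewrite Rintegral_itv_obnd_cbnd; last first.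
    apply: (RintegrableS mD _ _ intf) => //.
    by move=> x /=; rewrite !in_itv/= andbT => /andP[].
  have n0 : (0 : R) < n.+1%:R by rewrite ltr0n.
  have cF : continuous F.
    by move=> x; apply: derivable_continuous; have [] := dF x.
  rewrite /Rintegral (@continuous_FTC2 _ f F)//.
  - exact: continuous_subspaceT.
  - split; first by move=> x _; have [] := dF x.
      by apply: cvg_at_right_filter; exact: cF.
    by apply: cvg_at_left_filter; exact: cF.
  - by move=> x _; rewrite derive1E; have [] := dF x.
have lim2 : F n.+1%:R - F 0 @[n --> \oo] --> l - F 0.
  apply: cvgB; last exact: cvg_cst.
  by rewrite (cvg_shiftS (fun n : nat => F n%:R)).
rewrite (funext FE) in lim1.
by rewrite -(cvg_lim (@Rhausdorff R) lim1) (cvg_lim (@Rhausdorff R) lim2).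
Qed.

Lemma is_cderive_exp_line (z : R[i]) (t : R) :
  is_cderive (fun t => cexp (- z * t%:C)) t (- z * cexp (- z * t%:C)).
Proof.
apply: is_cderive_eq.
  apply: is_cderive_cexp; apply: is_cderiveM; first exact: is_cderive_cst.
  exact: is_cderive_of_real.
by rewrite mulr1 mul0r addr0.
Qed.

Lemma cmod_exp_line (z : R[i]) (t : R) :
  cmod (cexp (- z * t%:C)) = expR (- (Re z * t)).
Proof. by rewrite cmod_cexp ReM ReN ImN /= mulr0 subr0 mulNr. Qed.

Lemma exp_line_continuous (z : R[i]) (t : R) :
  ccontinuous_at (fun t : R => cexp (- z * t%:C)) t.
Proof. exact: is_cderive_continuous (is_cderive_exp_line z t). Qed.

Lemma exp_line_integral (z : R[i]) : 0 < Re z ->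
  (\int[mu]_(t in D) Re (cexp (- z * t%:C)) = Re z^-1) /\
  (\int[mu]_(t in D) Im (cexp (- z * t%:C)) = Im z^-1).
Proof.
move=> z0; have mD : measurable D by [].
have zn0 : z != 0 by apply/eqP => zE; rewrite zE ltxx in z0.
pose G t := - z^-1 * cexp (- z * t%:C).
have dG t : is_cderive G t (cexp (- z * t%:C)).
  apply: is_cderive_eq.
    by apply: is_cderiveM; [exact: is_cderive_cst|exact: is_cderive_exp_line].
  by rewrite mul0r addr0 mulrA mulrNN mulVf// mul1r.
have Gle t : cmod (G t) <= cmod z^-1 * expR (- (Re z * t)).
  by rewrite cmodM cmodN cmod_exp_line.
have Glim : cmod z^-1 * expR (- (Re z * n%:R)) @[n --> \oo] --> (0 : R).
  rewrite -(mulr0 (cmod z^-1)); apply: cvgMr.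
  rewrite (_ : (fun n : nat => _) = fun n : nat => expR (- Re z) ^+ n).
    apply: cvg_expr; rewrite ger0_norm ?expR_ge0// expR_lt1 oppr_lt0//.
  by apply/funext => n; rewrite -expRM_natr mulNr.
have G0 : G 0 = - z^-1 by rewrite /G mulr0 cexp0 mulr1.
have bnd (g : R[i] -> R) : (forall w, `|g w| <= cmod w) ->
    (forall t : R, {for t, continuous (fun t : R => g (cexp (- z * t%:C)))}) ->
    mu.-integrable D (EFin \o (fun t => g (cexp (- z * t%:C)))).
  move=> gle gc; apply: (integrable_dominated _ _ _ (exponential_integrable z0)) => //.
    by apply: measurable_funTS; exact: continuous_measurable_fun.
  by move=> t _; rewrite (le_trans (gle _))// cmod_exp_line.
have lim0 (g : R[i] -> R) : (forall w, `|g w| <= cmod w) ->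
    g (G n%:R) @[n --> \oo] --> (0 : R).
  move=> gle; apply/norm_cvg0P; apply: squeeze_cvgr (cvg_cst 0) Glim.
  by apply: nearW => n; rewrite normr_ge0 (le_trans (gle _)).
split.
- rewrite (_ : Rintegral _ _ _ = 0 - Re (G 0)); first by rewrite G0 ReN sub0r opprK.
  apply: (@Rintegral_halfline_FTC _ (Re \o G)).
  + by move=> t; have [] := dG t.
  + by move=> t; have [] := exp_line_continuous z t.
  + apply: bnd; first exact: normRe_le_cmod.
    by move=> t; have [] := exp_line_continuous z t.
  + exact: lim0 (@normRe_le_cmod R).
- rewrite (_ : Rintegral _ _ _ = 0 - Im (G 0)); first by rewrite G0 ImN sub0r opprK.
  apply: (@Rintegral_halfline_FTC _ (Im \o G)).
  + by move=> t; have [] := dG t.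
  + by move=> t; have [] := exp_line_continuous z t.
  + apply: bnd; first exact: normIm_le_cmod.
    by move=> t; have [] := exp_line_continuous z t.
  + exact: lim0 (@normIm_le_cmod R).
Qed.

End HalfLineIntegrals.

Section LaplaceOfSuperposition.
Local Open Scope complex_scope.
Context {R : realType}.
Local Notation mu := (@lebesgue_measure R).
Local Notation Re := (@complex.Re R).
Local Notation Im := (@complex.Im R).
Local Notation D := (`]0%R, +oo[%classic : set R).
Variable nu : R.
Hypotheses (nu_gt0 : 0 < nu) (nu_le : nu <= 2^-1).
Local Notation K := (stieltjes_kernel nu).
Variable h : R -> R.
Hypotheses (ch : continuous h) (h_le : forall x, `|h x| <= expR (nu * x)).

Definition exp_superposition (t : R) : R := \int[mu]_x (h x * expR (- (t * expR x))).
Local Notation H := exp_superposition.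

Lemma expR_expR_le (c t x : R) : 0 < c -> c <= t ->
  expR (- (t * expR x)) <= (Num.min 1 c)^-1 / (1 + expR x).
Proof.
move=> c0 ct; pose m := Num.min 1 c; have ex := expR_gt0 x.
have m0 : 0 < m by rewrite lt_min ltr01.
have m1 : m <= 1 by rewrite ge_min lexx.
have mc : m <= c by rewrite ge_min lexx orbT.
rewrite expRN -invfM lef_pV2 ?posrE ?expR_gt0 ?mulr_gt0//.
apply: (@le_trans _ _ (1 + t * expR x)); last by rewrite expR_ge1Dx.
by rewrite mulrDr mulr1 lerD// ler_wpM2r ?expR_ge0// (le_trans mc).
Qed.

Lemma superposition_le (c t x : R) : 0 < c -> c <= t ->
  `|h x * expR (- (t * expR x))| <= (Num.min 1 c)^-1 * K x.
Proof.
move=> c0 ct; rewrite normrM [X in _ * X]ger0_norm ?expR_ge0//.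
by rewrite mulrCA ler_pM ?expR_ge0// expR_expR_le.
Qed.

Lemma expR_expR_continuous_x (t : R) : continuous (fun x : R => expR (- (t * expR x))).
Proof.
move=> x; apply: (@continuous_comp _ _ _ (fun x : R => - (t * expR x)));
  last exact: continuous_expR.
by apply: cvgN; apply: cvgM; [exact: cvg_cst|exact: continuous_expR].
Qed.

Lemma expR_expR_continuous_t (x : R) : continuous (fun t : R => expR (- (t * expR x))).
Proof.
move=> t; apply: (@continuous_comp _ _ _ (fun t : R => - (t * expR x)));
  last exact: continuous_expR.
by apply: cvgN; apply: cvgM; [exact: cvg_id|exact: cvg_cst].
Qed.

Lemma superposition_integrable (t : R) : 0 < t ->
  mu.-integrable setT (EFin \o (fun x => h x * expR (- (t * expR x)))).
Proof.
move=> t0; apply: (@continuous_integrable_dominated _ _ (fun x => (Num.min 1 t)^-1 * K x)).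
- by move=> x; apply: cvgM; [exact: ch|exact: expR_expR_continuous_x].
- by move=> x; exact: superposition_le.
- by apply: RintegrableZ => //; exact: stieltjes_kernel_integrable.
Qed.

Lemma superposition_continuous : {in `]0, +oo[, continuous H}.
Proof.
move=> t; rewrite in_itv/= andbT => t0.
have t20 : 0 < t / 2 by rewrite divr_gt0.
have := @continuity_under_integral R _ _ mu (fun t x => h x * expR (- (t * expR x)))
  setT measurableT (t / 2) (t + 1) _ _ (fun x => (Num.min 1 (t / 2))^-1 * K x).
apply.
- move=> z; rewrite /= in_itv/= => /andP[z0 _]; apply: superposition_integrable.
  exact: lt_trans z0.
- apply: aeW => x _ z _; apply: cvgM; first exact: cvg_cst.
  exact: expR_expR_continuous_t.
- by apply: RintegrableZ => //; exact: stieltjes_kernel_integrable.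
- move=> z; rewrite /= in_itv/= => /andP[z0 _]; apply: aeW => x _.
  by apply: superposition_le => //; exact: ltW.
- rewrite inE/= in_itv/=; apply/andP; split; last by rewrite ltrDl.
  by rewrite ltr_pdivrMr// ltr_pMr// ltr1n.
Qed.

Lemma superposition_fubini (k : R -> R) (s : R) : 0 < s -> continuous k ->
  (forall t, 0 < t -> `|k t| <= expR (- (s * t))) ->
  mu.-integrable D (EFin \o (fun t => k t * H t)) /\
  \int[mu]_(t in D) (k t * H t) =
  \int[mu]_x (h x * \int[mu]_(t in D) (k t * expR (- (t * expR x)))).
Proof.
move=> s0 ck kle; have mD : measurable D by [].
pose F (p : R * R) : \bar R := ((k \_ D) p.1 * (h p.2 * expR (- (p.1 * expR p.2))))%:E.
have mk : measurable_fun setT k by exact: continuous_measurable_fun.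
have mkD : measurable_fun setT (k \_ D).
  by apply/(measurable_restrictT _ _).1 => //; exact: measurable_funTS.
have mF : measurable_fun setT F.
  apply/measurable_EFinP; apply: measurable_funM.
    exact: (measurableT_comp mkD measurable_fst).
  apply: measurable_funM.
    apply: (measurableT_comp _ measurable_snd); exact: continuous_measurable_fun.
  apply: (measurableT_comp (@measurable_expR R)); apply: measurableT_comp => //.
  apply: (@measurable_funM _ _ _ _ (fun p : R * R => p.1)); first exact: measurable_fst.
  exact: (measurableT_comp (@measurable_expR R) measurable_snd).
have Fin x t : D t -> F (t, x) = (k t * (h x * expR (- (t * expR x))))%:E.
  by move=> Dt; rewrite /F/= patchE mem_set.
have Fout x t : ~ D t -> F (t, x) = 0%E.
  by move=> Dt; rewrite /F/= patchE memNset// mul0r.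
have intF : (mu \x mu)%E.-integrable setT F.
  apply/integrable21ltyP => //.
  have iK : mu.-integrable setT (EFin \o (fun x => (Num.min 1 s)^-1 * K x)).
    by apply: RintegrableZ => //; exact: stieltjes_kernel_integrable.
  apply: (@le_lt_trans _ _ (\int[mu]_x ((Num.min 1 s)^-1 * K x)%:E)%E); last first.
    exact: (integrable_lty measurableT iK).
  apply: ge0_le_integral => //.
  - by move=> x _; exact: integral_ge0.
  - apply: (@measurable_fun_fubini_tonelli_G _ _ _ _ _ mu (fun p => `|F p|%E)) => //.
    exact: measurableT_comp.
  - exact: (measurable_int _ iK).
  move=> x _; have p0 : 0 < s + expR x by rewrite addr_gt0// expR_gt0.
  apply: (@le_trans _ _ (\int[mu]_t ((expR (nu * x) / (s + expR x))%:E *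
    (exponential_pdf (s + expR x) t)%:E))%E).
    apply: ge0_le_integral => //.
    + by apply: measurableT_comp => //; apply: measurableT_comp mF _; exact: measurable_pair2.
    + apply: measurable_funeM; apply/measurable_EFinP; exact: measurable_exponential_pdf.
    + move=> t _; have [Dt|Dt] := pselect (D t); last first.
        rewrite Fout// abse0 -EFinM lee_fin !mulr_ge0 ?expR_ge0 ?invr_ge0 ?(ltW p0)//.
        by rewrite exponential_pdf_ge0// ltW.
      have t0 : 0 < t by move: Dt; rewrite /= in_itv/= andbT.
      have pE : expR (nu * x) / (s + expR x) * exponential_pdf (s + expR x) t =
          expR (nu * x) * expR (- (s + expR x) * t).
        by rewrite exponential_pdfE ?(ltW t0)// mulrA divfK ?gt_eqF.
      rewrite Fin// -EFinM lee_fin pE.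
      rewrite normrM normrM [X in _ * (_ * X)]ger0_norm ?expR_ge0//.
      rewrite mulNr mulrDl opprD expRD mulrCA [expR x * t]mulrC.
      by rewrite ler_pM ?mulr_ge0 ?expR_ge0// ler_pM ?expR_ge0// kle.
  rewrite ge0_integralZl//.
  - rewrite integral_exponential_pdf// mule1 lee_fin.
    rewrite mulrCA ler_wpM2l ?expR_ge0// -invfM lef_pV2 ?posrE//.
      by rewrite mulrDr mulr1 lerD// ?ge_min ?lexx ?orbT// ler_piMl ?expR_ge0// ge_min lexx.
    by rewrite mulr_gt0// lt_min ltr01.
  - by apply/measurable_EFinP; exact: measurable_exponential_pdf.
  - by move=> t _; rewrite lee_fin exponential_pdf_ge0// ltW.
  - by rewrite lee_fin divr_ge0 ?expR_ge0// ltW.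
have I1 t : (\int[mu]_x F (t, x))%E = (((fun t => k t * H t) \_ D) t)%:E.
  have [Dt|Dt] := pselect (D t); last first.
    rewrite patchE memNset//; under eq_integral do rewrite Fout//.
    by rewrite integral0.
  rewrite patchE mem_set//; under eq_integral do rewrite Fin//.
  have t0 : 0 < t by move: Dt; rewrite /= in_itv/= andbT.
  have it := superposition_integrable t0.
  under eq_integral do rewrite EFinM.
  by rewrite integralZl// EFinM /H /Rintegral fineK// integrable_fin_num.
have I2 x : (\int[mu]_t F (t, x))%E =
    (h x * \int[mu]_(t in D) (k t * expR (- (t * expR x))))%:E.
  have ik : mu.-integrable D (EFin \o (fun t => k t * expR (- (t * expR x)))).
    apply: (integrable_dominated _ _ _ (exponential_integrable s0)) => //.
      apply: measurable_funTS; apply: continuous_measurable_fun => t.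
      by apply: cvgM; [exact: ck|exact: expR_expR_continuous_t].
    move=> t Dt; have t0 : 0 < t by move: Dt; rewrite /= in_itv/= andbT.
    rewrite normrM [X in _ * X]ger0_norm ?expR_ge0// -[leRHS]mulr1.
    by rewrite ler_pM ?expR_ge0// ?kle// expR_le1 oppr_le0 mulr_ge0 ?expR_ge0// ltW.
  transitivity (\int[mu]_(t in D) (h x * (k t * expR (- (t * expR x))))%:E)%E.
    rewrite [RHS]integral_mkcond; apply: eq_integral => t _.
    have [Dt|Dt] := pselect (D t); last by rewrite patchE memNset// Fout.
    by rewrite patchE mem_set// Fin// mulrCA.
  under eq_integral do rewrite EFinM.
  by rewrite integralZl// EFinM /Rintegral fineK// integrable_fin_num.
have iD : mu.-integrable setT (EFin \o ((fun t => k t * H t) \_ D)).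
  apply: eq_integrable (integrable_fubini_F intF) => // t _; exact: I1.
split; first by exact: (Rintegrable_patch _ mD).2.
rewrite Rintegral_mkcond /Rintegral; congr fine.
transitivity (\int[mu]_t \int[mu]_x F (t, x))%E.
  by apply: eq_integral => t _; rewrite I1.
by rewrite (Fubini intF); apply: eq_integral => x _; rewrite I2.
Qed.

Lemma laplace_superposition (s : R[i]) : 0 < Re s ->
  laplace_integrable H s /\
  laplace H s = cint (fun x => (h x)%:C / (s + (expR x)%:C)).
Proof.
move=> s0.
have kle (g : R[i] -> R) : (forall w, `|g w| <= cmod w) ->
    forall t, 0 < t -> `|g (cexp (- s * t%:C))| <= expR (- (Re s * t)).
  by move=> gle t _; rewrite (le_trans (gle _))// cmod_exp_line.
have cRe : continuous (fun t : R => Re (cexp (- s * t%:C))).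
  by move=> t; have [] := exp_line_continuous s t.
have cIm : continuous (fun t : R => Im (cexp (- s * t%:C))).
  by move=> t; have [] := exp_line_continuous s t.
have [i1 e1] := superposition_fubini s0 cRe (kle _ (@normRe_le_cmod R)).
have [i2 e2] := superposition_fubini s0 cIm (kle _ (@normIm_le_cmod R)).
have LR t : Re (laplace_integrand H s t) = Re (cexp (- s * t%:C)) * H t.
  by rewrite /laplace_integrand ReM /= mulr0 subr0.
have LI t : Im (laplace_integrand H s t) = Im (cexp (- s * t%:C)) * H t.
  by rewrite /laplace_integrand ImM /= mulr0 add0r.
split; first by split; rewrite ?(funext LR) ?(funext LI).
have expE (t x : R) : cexp (- s * t%:C) * (expR (- (t * expR x)))%:C =
    cexp (- (s + (expR x)%:C) * t%:C).
  rewrite -cexp_real -cexpD; congr cexp.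
  by rewrite rmorphN rmorphM /=; ring.
have z0 (x : R) : 0 < Re (s + (expR x)%:C).
  by rewrite ReD; exact: (addr_gt0 s0 (expR_gt0 x)).
apply: complex_eqP.
- transitivity (\int[mu]_(t in D) (Re (cexp (- s * t%:C)) * H t)).
    by rewrite -(funext LR).
  rewrite e1 /cint [RHS]/=; apply: eq_Rintegral => x _.
  rewrite ReM /= mul0r subr0 -(exp_line_integral (z0 x)).1; congr (_ * _).
  by apply: eq_Rintegral => t _; rewrite -expE ReM /= mulr0 subr0.
- transitivity (\int[mu]_(t in D) (Im (cexp (- s * t%:C)) * H t)).
    by rewrite -(funext LI).
  rewrite e2 /cint [RHS]/=; apply: eq_Rintegral => x _.
  rewrite ImM /= mul0r addr0 -(exp_line_integral (z0 x)).2; congr (_ * _).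
  by apply: eq_Rintegral => t _; rewrite -expE ImM /= mulr0 add0r.
Qed.

End LaplaceOfSuperposition.

Section HausdorffPositivity.
Context {R : realType}.
Local Notation mu := (@lebesgue_measure R).
Local Notation D := (`]0%R, +oo[%classic : set R).
Implicit Types (F G : nat -> R) (P : {poly R}).

(* A function that is negative at t0 is detected by the powers of a polynomial
   in exp (- t) that exceeds 1 only near t0. *)
Lemma ge0_of_exp_moments (g : R -> R) : {in `]0, +oo[, continuous g} ->
  mu.-integrable D (EFin \o g) ->
  (forall P, (forall u : R, 0 <= u <= 1 -> 0 <= P.[u]) ->
    0 <= \int[mu]_(t in D) (P.[expR (- t)] * g t)) ->
  forall t, 0 < t -> 0 <= g t.
Proof.
move=> cg ig mom t0 t00; rewrite leNgt; apply/negP => gneg.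
have mD : measurable D by [].
pose c := - g t0 / 2; have c0 : 0 < c by rewrite divr_gt0// oppr_gt0.
have cgt0 : {for t0, continuous g} by apply: cg; rewrite in_itv/= t00.
have : \forall t \near t0, g t < - c.
  have := cgt0; rewrite /prop_for/continuous_at => /cvgr_lt; apply.
  by rewrite /c; lra.
move=> /nbhs_ballP[d /= d0 gd].
set e0 := expR (- t0); have e00 : 0 < e0 by exact: expR_gt0.
have e01 : e0 < 1 by rewrite expR_lt1 oppr_lt0.
pose eta := Num.min (expR (- (t0 - d)) - e0) (e0 - expR (- (t0 + d))).
have eta0 : 0 < eta.
  by rewrite lt_min !subr_gt0 !ltr_expR; apply/andP; split; lra.
have etad t : `|expR (- t) - e0| < eta -> `|t - t0| < d.
  rewrite !ltr_norml => /andP[h1 h2].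
  have l1 : eta <= expR (- (t0 - d)) - e0 by rewrite ge_min lexx.
  have l2 : eta <= e0 - expR (- (t0 + d)) by rewrite ge_min lexx orbT.
  have : expR (- t) < expR (- (t0 - d)) by lra.
  have : expR (- (t0 + d)) < expR (- t) by lra.
  by rewrite !ltr_expR => ? ?; apply/andP; split; lra.
pose eps := eta ^+ 2; have eps0 : 0 < eps by rewrite exprn_gt0.
pose P : {poly R} := (1 + eps)%:P - ('X - e0%:P) ^+ 2.
have PE (u : R) : P.[u] = 1 + eps - (u - e0) ^+ 2 by rewrite /P !hornerE.
have Pge (u : R) : 0 <= u <= 1 -> eps <= P.[u].
  move=> /andP[u0 u1]; rewrite PE.
  have ue : `|u - e0| <= 1 by rewrite ler_norml; apply/andP; split; lra.
  have : `|u - e0| ^+ 2 <= 1 by rewrite exprn_ile1.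
  by rewrite real_normK ?num_real//; lra.
pose A := `[t0, t0 + eta / 2]%classic : set R.
have mA : measurable A by exact: measurable_itv.
have e1 (t : R) : 0 < t -> 0 <= expR (- t) <= 1.
  by move=> tp; rewrite expR_ge0 expR_le1 oppr_le0 ltW.
have Aeta t : A t -> `|expR (- t) - e0| <= eta / 2.
  rewrite /A/= in_itv/= => /andP[t1 t2].
  rewrite ler0_norm; last by rewrite subr_le0 ler_expR lerN2.
  have : expR (- t) = e0 * expR (- (t - t0)) by rewrite -expRD; congr expR; ring.
  have := expR_ge1Dx (- (t - t0)).
  by move=> h1 ->; nra.
have key n t : D t -> P.[expR (- t)] ^+ n * g t <=
    `|g t| - c * (1 + eps / 2) ^+ n * \1_A t.
  rewrite /= in_itv/= andbT => tp; have Pe := Pge _ (e1 _ tp).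
  have Pn0 : 0 <= P.[expR (- t)] ^+ n by rewrite exprn_ge0// (le_trans (ltW eps0)).
  have [te|te] := ltP `|expR (- t) - e0| eta.
    have gt : g t < - c by apply: gd; rewrite /ball/= distrC etad.
    have gt0 : g t <= 0 by lra.
    rewrite indicE; have [tA|tA] := pselect (A t); last first.
      by rewrite memNset// mulr0 subr0 (@le_trans _ _ 0)// mulr_ge0_le0.
    rewrite mem_set// mulr1.
    have PA : 1 + eps / 2 <= P.[expR (- t)].
      have eta20 : 0 <= eta / 2 by exact/ltW/divr_gt0.
      have : `|expR (- t) - e0| ^+ 2 <= (eta / 2) ^+ 2.
        by rewrite lerXn2r// ?nnegrE// Aeta.
      by rewrite PE real_normK ?num_real// expr_div_n -/eps; lra.
    have PAn : (1 + eps / 2) ^+ n <= P.[expR (- t)] ^+ n.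
      by rewrite lerXn2r// nnegrE; lra.
    have := normr_ge0 (g t); nra.
  have tA : ~ A t by move=> /Aeta; lra.
  rewrite indicE memNset// mulr0 subr0.
  have P1 : P.[expR (- t)] <= 1.
    have : eta ^+ 2 <= `|expR (- t) - e0| ^+ 2 by rewrite lerXn2r// nnegrE ltW.
    by rewrite real_normK ?num_real// -/eps PE; lra.
  have Pn1 : P.[expR (- t)] ^+ n <= 1 by rewrite exprn_ile1//; lra.
  apply: (le_trans (ler_norm _)); rewrite normrM ger0_norm//.
  by rewrite ler_piMl.
pose B := \int[mu]_(t in D) `|g t|.
have iA : mu.-integrable D (EFin \o \1_A).
  apply: (RintegrableS measurableT) => //.
  exact: integrable_indic_itv.
have AE : \int[mu]_(t in D) \1_A t = eta / 2.
  rewrite /Rintegral integral_indic//= (_ : A `&` D = A); last first.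
    apply: setIidl => t; rewrite /A/= !in_itv/= => /andP[t1 _].
    by rewrite (lt_le_trans t00).
  rewrite /A lebesgue_measure_itv/= lte_fin ltrDl divr_gt0//=.
  by rewrite addrAC subrr add0r.
have mg : measurable_fun D g by have /measurable_int/measurable_EFinP := ig.
have ing : mu.-integrable D (EFin \o (fun t => `|g t|)) by exact: integrable_norm.
have Bn n : 0 <= B - c * (1 + eps / 2) ^+ n * (eta / 2).
  have Pn : forall u, 0 <= u <= 1 -> 0 <= (P ^+ n).[u].
    by move=> u u01; rewrite horner_exp exprn_ge0// (le_trans (ltW eps0))// Pge.
  apply: (le_trans (mom _ Pn)).
  have iAn := RintegrableZ (c * (1 + eps / 2) ^+ n) mD iA.
  rewrite -AE -RintegralZl// -RintegralB//.
  apply: le_Rintegral => //.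
  - apply: (@integrable_dominated _ _ _ (fun t => (1 + eps) ^+ n * `|g t|)) => //.
    + apply: measurable_funM => //; apply: measurable_funTS.
      apply: continuous_measurable_fun => t.
      apply: (@continuous_comp _ _ _ (fun t : R => expR (- t)) (horner (P ^+ n))).
        apply: (@continuous_comp _ _ _ (fun t : R => - t) (@expR R)).
          exact: opp_continuous.
        exact: continuous_expR.
      exact: continuous_horner.
    + move=> t; rewrite /= in_itv/= andbT => tp; rewrite normrM ler_wpM2r//.
      rewrite horner_exp normrX lerXn2r ?nnegrE//; first by rewrite addr_ge0// ltW.
      have Pe := Pge _ (e1 _ tp).
      rewrite ger0_norm; last by rewrite (le_trans (ltW eps0)).
      by rewrite PE lerBlDr lerDl sqr_ge0.
    + exact: RintegrableZ.
  - exact: RintegrableB.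
  - by move=> t Dt; rewrite horner_exp; exact: key.
have [n nB] : exists n : nat, B < c * (n%:R * (eps / 2)) * (eta / 2).
  have eps2 : 0 < eps / 2 by rewrite divr_gt0.
  have eta2 : 0 < eta / 2 by rewrite divr_gt0.
  have k0 := mulr_gt0 (mulr_gt0 c0 eps2) eta2.
  exists (Num.bound (B / (c * (eps / 2) * (eta / 2)))).
  have B0 : 0 <= B by exact: Rintegral_ge0.
  have := archi_boundP (divr_ge0 B0 (ltW k0)); rewrite ltr_pdivrMr//.
  by move=> /lt_le_trans; apply; rewrite le_eqVlt; apply/orP; left; apply/eqP; ring.
have bern : 1 + n%:R * (eps / 2) <= (1 + eps / 2) ^+ n.
  have e20 : 0 <= eps / 2 by rewrite divr_ge0// ltW.
  elim: n {nB} => [|n IH]; first by rewrite mul0r addr0 expr0.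
  rewrite exprS -natr1; have n0 : 0 <= (n%:R : R) by [].
  have := mulr_ge0 n0 (mulr_ge0 e20 e20).
  have := mulr_ge0 e20 (_ : 0 <= (1 + eps / 2) ^+ n - (1 + n%:R * (eps / 2))).
  by rewrite subr_ge0 => /(_ IH); nra.
have := Bn n; have h := mulr_gt0 c0 eta0.
have : c * (n%:R * (eps / 2)) * (eta / 2) <= c * (1 + eps / 2) ^+ n * (eta / 2).
  rewrite ler_pM2r ?divr_gt0// ler_pM2l//; lra.
by lra.
Qed.

(* Hausdorff's condition for F to be a moment sequence on [0, 1]. For F i =
   f (1 + i) it stands in for the complete monotonicity of f. *)
Definition hausdorff_pos F : Prop :=
  forall P, (forall u : R, 0 <= u <= 1 -> 0 <= P.[u]) -> 0 <= \sum_(i < size P) P`_i * F i.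

Definition hausdorff_mult G : Prop :=
  forall F, hausdorff_pos F -> hausdorff_pos (fun i => G i * F i).

Lemma sum_coef_widen P n F : (size P <= n)%N ->
  \sum_(i < size P) P`_i * F i = \sum_(i < n) P`_i * F i.
Proof.
move=> sn; rewrite (big_ord_widen n (fun i => P`_i * F i) sn) big_mkcond/=.
by apply: eq_bigr => i _; case: ltnP => // si; rewrite nth_default// mul0r.
Qed.

Lemma hausdorff_pos1 : hausdorff_pos (fun=> 1).
Proof.
move=> P P0; have := P0 1; rewrite ler01 lexx => /(_ isT); rewrite horner_coef.
by under eq_bigr do rewrite expr1n.
Qed.

Lemma hausdorff_pos0 : hausdorff_pos (fun=> 0).
Proof. by move=> P _; rewrite big1// => i _; rewrite mulr0. Qed.

Lemma hausdorff_mult_geom (k r : R) : 0 <= k -> 0 <= r <= 1 ->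
  hausdorff_mult (fun i => k * r ^+ i).
Proof.
move=> k0 /andP[r0 r1] F Fpos P P0.
pose Q := \poly_(i < size P) (k * (P`_i * r ^+ i)).
have QE u : Q.[u] = k * P.[r * u].
  rewrite horner_poly horner_coef mulr_sumr; apply: eq_bigr => i _.
  by rewrite exprMn; ring.
have Q0 u : 0 <= u <= 1 -> 0 <= Q.[u].
  move=> /andP[u0 u1]; rewrite QE mulr_ge0// P0// mulr_ge0//=.
  by rewrite mulr_ile1.
have := Fpos Q Q0; rewrite (@sum_coef_widen Q (size P)) ?size_poly//.
congr (_ <= _); apply: eq_bigr => i _; rewrite coef_poly ltn_ord; ring.
Qed.

Lemma hausdorff_multM G G' : hausdorff_mult G -> hausdorff_mult G' ->
  hausdorff_mult (fun i => G i * G' i).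
Proof.
move=> mG mG' F Fpos P P0; have := mG _ (mG' _ Fpos) P P0.
by under eq_bigr do rewrite (mulrA (G _)).
Qed.

Lemma hausdorff_multD G G' : hausdorff_mult G -> hausdorff_mult G' ->
  hausdorff_mult (fun i => G i + G' i).
Proof.
move=> mG mG' F Fpos P P0; have := addr_ge0 (mG _ Fpos P P0) (mG' _ Fpos P P0).
rewrite -big_split/=; congr (_ <= _).
by apply: eq_bigr => i _; rewrite mulrDl mulrDr.
Qed.

Lemma hausdorff_mult_cst (k : R) : 0 <= k -> hausdorff_mult (fun=> k).
Proof.
move=> k0; have r1 : (0 : R) <= (1 : R) <= (1 : R) by rewrite ler01 lexx.
have := hausdorff_mult_geom k0 r1; congr hausdorff_mult.
by apply/funext => i; rewrite expr1n mulr1.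
Qed.

Lemma hausdorff_mult_cvg (G_ : nat -> nat -> R) G :
  (forall n, hausdorff_mult (G_ n)) ->
  (forall i, G_ n i @[n --> \oo] --> G i) -> hausdorff_mult G.
Proof.
move=> mG cG F Fpos P P0.
have lim : \sum_(i < size P) P`_i * (G_ n i * F i) @[n --> \oo] -->
    \sum_(i < size P) P`_i * (G i * F i).
  elim: (size P) => [|m IH].
    by under eq_fun do rewrite big_ord0; rewrite big_ord0; exact: cvg_cst.
  under eq_fun do rewrite big_ord_recr/=.
  rewrite big_ord_recr/=; apply: cvgD => //; apply: cvgM; first exact: cvg_cst.
  by apply: cvgM; [exact: cG|exact: cvg_cst].
rewrite -(cvg_lim (@Rhausdorff R) lim); apply: limr_ge.
  by apply/cvg_ex; eexists; exact: lim.
by apply: nearW => n; exact: mG.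
Qed.

Lemma hausdorff_mult_integral (A : set R) (k : nat -> R -> R) : measurable A ->
  (forall i, mu.-integrable A (EFin \o k i)) ->
  (forall x, A x -> hausdorff_mult (k ^~ x)) ->
  hausdorff_mult (fun i => \int[mu]_(x in A) k i x).
Proof.
move=> mA ik mk F Fpos P P0.
have sumE n : mu.-integrable A (EFin \o (fun x => \sum_(i < n) P`_i * (k i x * F i))) /\
    \int[mu]_(x in A) (\sum_(i < n) P`_i * (k i x * F i)) =
    \sum_(i < n) P`_i * ((\int[mu]_(x in A) k i x) * F i).
  elim: n => [|n [IH1 IH2]].
    split.
      rewrite (_ : (fun x => _) = cst 0); first exact: integrable0.
      by apply/funext => x; rewrite big_ord0.
    under eq_Rintegral do rewrite big_ord0.
    by rewrite big_ord0 Rintegral_cst// mul0r.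
  have tE : (fun x => P`_n * (k n x * F n)) = (fun x => (P`_n * F n) * k n x).
    by apply/funext => x; ring.
  have it : mu.-integrable A (EFin \o (fun x => P`_n * (k n x * F n))).
    by rewrite tE; exact: RintegrableZ.
  split.
    have := RintegrableD mA IH1 it; apply: eq_integrable => // x _.
    by rewrite /= big_ord_recr.
  under eq_Rintegral do rewrite big_ord_recr/=.
  rewrite RintegralD// IH2 big_ord_recr/=; congr (_ + _).
  by rewrite tE RintegralZl//; ring.
have [_ <-] := sumE (size P).
by apply: Rintegral_ge0 => x Ax; exact: mk.
Qed.

Lemma hausdorff_mult_expR G : hausdorff_mult G -> hausdorff_mult (fun i => expR (G i)).
Proof.
move=> mG; pose S n i := series (exp_coeff (G i)) n.
apply: (@hausdorff_mult_cvg S); last first.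
  by move=> i; exact: is_cvg_series_exp_coeff.
have powG n : hausdorff_mult (fun i => G i ^+ n).
  elim: n => [|n IH]; first by under eq_fun do rewrite expr0; exact: hausdorff_mult_cst.
  rewrite (_ : (fun i => _) = (fun i => G i * G i ^+ n)); first exact: hausdorff_multM.
  by apply/funext => i; rewrite exprS.
elim=> [|n IH].
  rewrite /S; under eq_fun do rewrite /series/= big_geq//.
  exact: hausdorff_mult_cst.
have -> : S n.+1 = (fun i => S n i + G i ^+ n * n`!%:R^-1).
  by apply/funext => i; rewrite /S /series/= big_nat_recr.
apply: hausdorff_multD => //; apply: hausdorff_multM => //.
exact: hausdorff_mult_cst.
Qed.

Lemma hausdorff_mult_inv (s : R) : 0 < s -> hausdorff_mult (fun i => (s + i%:R)^-1).
Proof.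
move=> s0; have mD : measurable D by [].
have p0 i : 0 < s + i%:R by rewrite ltr_pwDl.
have := @hausdorff_mult_integral D (fun i t => expR (- ((s + i%:R) * t))) mD.
have E i : \int[mu]_(t in D) expR (- ((s + i%:R) * t)) = (s + i%:R)^-1.
  have z0 : 0 < complex.Re (real_complex _ (s + i%:R)) by exact: p0.
  have [+ _] := exp_line_integral z0.
  rewrite -fmorphV /= => <-; apply: eq_Rintegral => t _.
  by rewrite /= !(mulr0, oppr0, mul0r, addr0, cos0, mulr1, subr0) mulNr.
rewrite (funext E); apply.
  by move=> i; exact: exponential_integrable.
move=> t; rewrite /= in_itv/= andbT => t0.
have -> : (fun i : nat => expR (- ((s + i%:R) * t))) =
    (fun i => expR (- (s * t)) * expR (- t) ^+ i).
  apply/funext => i; rewrite -expRM_natr -expRD; congr expR; ring.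
apply: hausdorff_mult_geom; first exact: expR_ge0.
by rewrite expR_ge0 expR_le1 oppr_le0 ltW.
Qed.

End HausdorffPositivity.

Section PrincipalBranch.
Local Open Scope complex_scope.
Context {R : realType}.
Local Notation Re := (@complex.Re R).
Local Notation Im := (@complex.Im R).
Implicit Type s : R[i].

Lemma acos_lt_pihalf (u : R) : 0 < u <= 1 -> acos u < pi / 2.
Proof.
move=> /andP[u0 u1]; have u11 : -1 <= u <= 1 by rewrite u1 andbT; lra.
have pi0 := pi_gt0 R.
rewrite -ltr_cos ?in_itv/= ?acos_ge0 ?acos_lepi//; last by apply/andP; split; lra.
by rewrite cos_pihalf acosK// in_itv.
Qed.

Lemma cexp_log s : 0 < Re s ->
  cexp (ln (cmod s) +i* carg s) = s /\ `|carg s| < pi / 2.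
Proof.
move=> s0; have sn0 : 0 < cmod s.
  by rewrite cmod_gt0; apply/eqP => sE; rewrite sE ltxx in s0.
have u0 : 0 < Re s / cmod s by rewrite divr_gt0.
have u1 : Re s / cmod s <= 1.
  by rewrite ler_pdivrMr// mul1r (le_trans (ler_norm _))// normRe_le_cmod.
have u11 : -1 <= Re s / cmod s <= 1 by rewrite u1 andbT; lra.
have cosE : cos (acos (Re s / cmod s)) = Re s / cmod s by rewrite acosK// in_itv.
have sinE : sin (acos (Re s / cmod s)) = `|Im s| / cmod s.
  rewrite sin_acos// -[RHS]ger0_norm ?divr_ge0 ?cmod_ge0// -sqrtr_sqr.
  congr Num.sqrt; rewrite !expr_div_n real_normK ?num_real// sqr_cmod.
  have d0 : Re s ^+ 2 + Im s ^+ 2 != 0 by rewrite -sqr_cmod sqrf_eq0 gt_eqF.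
  by field.
have a0 : 0 <= acos (Re s / cmod s) by exact: acos_ge0.
have a2 : acos (Re s / cmod s) < pi / 2 by apply: acos_lt_pihalf; rewrite u0.
split.
- rewrite cexp_pair lnK ?posrE//; apply: complex_eqP; rewrite !cRI /= !mul0r.
    rewrite subr0 (_ : cos (carg s) = Re s / cmod s).
      by rewrite mulrC divfK// gt_eqF.
    by rewrite /carg; case: ifP => _; rewrite ?cosN.
  rewrite addr0 (_ : sin (carg s) = Im s / cmod s).
    by rewrite mulrC divfK// gt_eqF.
  rewrite /carg; case: ifPn => i0; first by rewrite sinE ger0_norm.
  by rewrite sinN sinE ltr0_norm ?ltNge// mulNr opprK.
- by rewrite /carg; case: ifP => _; rewrite ?normrN ger0_norm.
Qed.

Lemma cpow_log s (b : R) : 0 < Re s ->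
  cpow s b = cexp (b%:C * (ln (cmod s) +i* carg s)).
Proof.
by move=> s0; rewrite /cpow; case: eqP => // sE; rewrite sE ltxx in s0.
Qed.

End PrincipalBranch.

Section LaplaceUniqueness.
Local Open Scope complex_scope.
Context {R : realType}.
Local Notation mu := (@lebesgue_measure R).
Local Notation D := (`]0%R, +oo[%classic : set R).
Local Notation Re := (@complex.Re R).
Local Notation Im := (@complex.Im R).
Implicit Types (y : R -> R) (F : R[i] -> R[i]).

Lemma laplaceZ (k : R) y s : laplace_integrable y s ->
  laplace_integrable (fun t => k * y t) s /\
  laplace (fun t => k * y t) s = k%:C * laplace y s.
Proof.
move=> [i1 i2]; have mD : measurable D by [].
have LR t : Re (laplace_integrand (fun t => k * y t) s t) =
    k * Re (laplace_integrand y s t).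
  by rewrite /laplace_integrand !ReM /= !mulr0 !subr0 mulrCA.
have LI t : Im (laplace_integrand (fun t => k * y t) s t) =
    k * Im (laplace_integrand y s t).
  by rewrite /laplace_integrand !ImM /= !mulr0 !add0r mulrCA.
split.
  by split; rewrite ?(funext LR) ?(funext LI); exact: RintegrableZ.
apply: complex_eqP; rewrite ?ReM ?ImM /= mul0r ?subr0 ?addr0.
- rewrite -(@RintegralZl _ _ _ mu D (fun t => Re (laplace_integrand y s t)))//.
  by apply: eq_Rintegral => t _; exact: LR.
- rewrite -(@RintegralZl _ _ _ mu D (fun t => Im (laplace_integrand y s t)))//.
  by apply: eq_Rintegral => t _; exact: LI.
Qed.

Definition real_laplace y (c : R) (f : R -> R) : Prop := forall s : R, c < s ->
  mu.-integrable D (EFin \o (fun t => expR (- (s * t)) * y t)) /\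
  \int[mu]_(t in D) (expR (- (s * t)) * y t) = f s.

Lemma laplace_real F y (c : R) : (forall s, c < Re s ->
    laplace_integrable y s /\ laplace y s = F s) ->
  real_laplace y c (fun s => Re (F s%:C)).
Proof.
move=> hc s cs; have [[i1 _] <-] := hc s%:C cs.
have LR t : Re (laplace_integrand y s%:C t) = expR (- (s * t)) * y t.
  rewrite /laplace_integrand (_ : - s%:C * t%:C = (- (s * t))%:C).
    by rewrite cexp_real ReM /= mulr0 subr0.
  by rewrite rmorphN rmorphM mulNr.
by rewrite (funext LR) in i1; split => //; rewrite -(funext LR).
Qed.

Lemma real_laplace_ge0 y (c s0 : R) (f : R -> R) : real_laplace y c f ->
  {in `]0, +oo[, continuous y} -> c < s0 ->
  hausdorff_pos (fun i => f (s0 + i%:R)) -> forall t, 0 < t -> 0 <= y t.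
Proof.
move=> yf cy cs0 fpos; have mD : measurable D by [].
have [ig _] := yf _ cs0.
suff : forall t, 0 < t -> 0 <= expR (- (s0 * t)) * y t.
  by move=> H t /H; rewrite pmulr_rge0// expR_gt0.
apply: ge0_of_exp_moments => //.
  move=> t t0; apply: cvgM; last exact: cy.
  apply: (@continuous_comp _ _ _ (fun t : R => - (s0 * t))); last exact: continuous_expR.
  by apply: cvgN; apply: cvgM; [exact: cvg_cst|exact: cvg_id].
move=> P P0; have := fpos P P0.
have sumE n : mu.-integrable D (EFin \o (fun t =>
      (\sum_(i < n) P`_i * expR (- t) ^+ i) * (expR (- (s0 * t)) * y t))) /\
    \int[mu]_(t in D)
      ((\sum_(i < n) P`_i * expR (- t) ^+ i) * (expR (- (s0 * t)) * y t)) =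
    \sum_(i < n) P`_i * f (s0 + i%:R).
  elim: n => [|n [IH1 IH2]].
    have E0 : (fun t => (\sum_(i < 0) P`_i * expR (- t) ^+ i) *
        (expR (- (s0 * t)) * y t)) = cst 0.
      by apply/funext => t; rewrite big_ord0 mul0r.
    by rewrite E0 big_ord0; split; [exact: integrable0|rewrite Rintegral_cst// mul0r].
  have cs : c < s0 + n%:R by rewrite (lt_le_trans cs0)// lerDl.
  have [in_ en] := yf _ cs; rewrite big_ord_recr/= -IH2 -en.
  have E1 : (fun t => (\sum_(i < n.+1) P`_i * expR (- t) ^+ i) *
      (expR (- (s0 * t)) * y t)) = (fun t => (\sum_(i < n) P`_i * expR (- t) ^+ i) *
      (expR (- (s0 * t)) * y t) + P`_n * (expR (- ((s0 + n%:R) * t)) * y t)).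
    apply/funext => t; rewrite big_ord_recr/= mulrDl; congr (_ + _).
    have -> : expR (- ((s0 + n%:R) * t)) = expR (- t) ^+ n * expR (- (s0 * t)).
      by rewrite -expRM_natr -expRD; congr expR; ring.
    by ring.
  rewrite E1; have iZ := RintegrableZ P`_n mD in_.
  by split; [exact: RintegrableD|rewrite RintegralD// RintegralZl].
have [_ <-] := sumE (size P); congr (_ <= _).
by apply: eq_Rintegral => t _; rewrite horner_coef.
Qed.

Lemma inverse_laplace_unique F y1 y2 : is_inverse_laplace F y1 ->
  is_inverse_laplace F y2 -> forall t, 0 < t -> y1 t = y2 t.
Proof.
suff le z1 z2 : is_inverse_laplace F z1 -> is_inverse_laplace F z2 ->
    forall t, 0 < t -> z1 t <= z2 t.
  by move=> h1 h2 t t0; apply: le_anti; rewrite !le.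
move=> h1 h2 t t0; have mD : measurable D by [].
case: h1 h2 => [k1 [c1 /laplace_real l1]] [k2 [c2 /laplace_real l2]].
rewrite -subr_ge0.
apply: (@real_laplace_ge0 (fun t => z2 t - z1 t) (Num.max c1 c2)
  (Num.max c1 c2 + 1) (fun=> 0)) t0.
- move=> s; rewrite gt_max => /andP[/l1[i1 e1] /l2[i2 e2]].
  have E : (fun t => expR (- (s * t)) * (z2 t - z1 t)) =
      (fun t => expR (- (s * t)) * z2 t - expR (- (s * t)) * z1 t).
    by apply/funext => r; rewrite mulrBr.
  by rewrite E; split; [exact: RintegrableB|rewrite RintegralB// e1 e2 subrr].
- by move=> r r0; apply: cvgB; [exact: k2|exact: k1].
- by rewrite ltrDl.
- exact: hausdorff_pos0.
Qed.

Lemma inverse_laplaceE F y : is_inverse_laplace F y ->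
  forall t, 0 < t -> inverse_laplace F t = y t.
Proof.
move=> hy; apply: (inverse_laplace_unique _ hy).
by apply: (@xgetPex _ (fun=> 0) [set z | is_inverse_laplace F z]); exists y.
Qed.

End LaplaceUniqueness.

Section WrightDensity.
Local Open Scope complex_scope.
Context {R : realType}.
Local Notation mu := (@lebesgue_measure R).
Local Notation Re := (@complex.Re R).
Local Notation Im := (@complex.Im R).
Variable nu : R.
Hypotheses (nu_gt0 : 0 < nu) (nu_le : nu <= 2^-1).

Local Notation h a := (fun x => expR (nu * x) * cut_density nu a x).

Definition wright_density (a t : R) : R :=
  (stieltjes_const nu * sin (nu * pi))^-1 * exp_superposition (h a) t.

Lemma wright_const_gt0 : 0 < stieltjes_const nu * sin (nu * pi).
Proof. by rewrite mulr_gt0 ?stieltjes_const_gt0 ?sin_nupi_gt0. Qed.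

Lemma cut_integrand_continuous a : continuous (h a).
Proof.
by move=> x; apply: cvgM; [exact: expR_scale_continuous|exact: cut_density_continuous_x].
Qed.

Lemma cut_integrand_le a x : 0 <= a -> `|h a x| <= expR (nu * x).
Proof.
move=> a0; rewrite normrM ger0_norm ?expR_ge0// ler_piMr ?expR_ge0//.
exact: cut_density_le1.
Qed.

Lemma wright_density_laplace (a : R) (s : R[i]) : 0 <= a -> 0 < Re s ->
  laplace_integrable (wright_density a) s /\
  laplace (wright_density a) s =
  cpow s (- (1 - nu)) * cexp (- a%:C * cpow s nu).
Proof.
move=> a0 s0; have hle x := cut_integrand_le x a0.
have hc := @cut_integrand_continuous a.
have [L1 L2] := laplace_superposition nu_gt0 nu_le hc hle s0.
have [I E] := laplaceZ (stieltjes_const nu * sin (nu * pi))^-1 L1.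
split => //; rewrite [LHS]E L2; have [sE sphi] := cexp_log s0.
have := stieltjes_representation nu_gt0 nu_le (ln (cmod s)) a0 sphi.
rewrite sE => ->; rewrite !cpow_log// mulrA -rmorphM /= mulVf ?gt_eqF ?wright_const_gt0//.
by rewrite mul1r opprB.
Qed.

Lemma wright_density_is_inverse_laplace (a : R) : 0 <= a ->
  is_inverse_laplace
    (fun s => cpow s (- (1 - nu)) * cexp (- a%:C * cpow s nu)) (wright_density a).
Proof.
move=> a0; split; last by exists 0 => s s0; exact: wright_density_laplace.
have hle x := cut_integrand_le x a0; have hc := @cut_integrand_continuous a.
move=> t t0; apply: cvgM; first exact: cvg_cst.
exact: (superposition_continuous nu_gt0 nu_le hc hle t0).
Qed.

Lemma stieltjes_power_real (s : R) : 0 < s ->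
  mu.-integrable setT (EFin \o (fun x => expR (nu * x) / (s + expR x))) /\
  \int[mu]_x (expR (nu * x) / (s + expR x)) =
  stieltjes_const nu * expR ((nu - 1) * ln s).
Proof.
move=> s0; have pi20 : `|0 : R| < pi / 2 by rewrite normr0 divr_gt0// pi_gt0.
have E x : (expR (nu * x))%:C / (cexp (ln s +i* 0) + (expR x)%:C) =
    (expR (nu * x) / (s + expR x))%:C.
  by rewrite cexp_real lnK ?posrE// -rmorphD -fmorphV -rmorphM.
have := stieltjes_power nu_gt0 nu_le (ln s) pi20.
rewrite (funext E) cint_real real_mul_pair mulr0 cexp_real -rmorphM => /(congr1 Re) e.
split; last exact: e.
have z0 : 0 < Re s%:C by [].
have [|+ _] := cdiv_cintegrable nu_gt0 nu_le z0 (expR_scale_continuous (k := nu)).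
  by move=> x; rewrite ger0_norm ?expR_ge0.
congr (is_true (mu.-integrable _ _)); apply/funext => x /=.
have d0 : s + expR x != 0 by rewrite gt_eqF// addr_gt0// expR_gt0.
by congr EFin; field.
Qed.

Lemma wright_laplace_hausdorff (a : R) : 0 <= a ->
  hausdorff_pos (fun i => expR ((nu - 1) * ln (1 + i%:R)) *
    expR (- (a * expR (nu * ln (1 + i%:R))))).
Proof.
move=> a0; have p0 i : (0 : R) < 1 + i%:R by rewrite ltr_pwDl.
have C0 := stieltjes_const_gt0 nu_gt0 nu_le.
have multK x : hausdorff_mult (fun i => expR (nu * x) / (1 + i%:R + expR x)).
  apply: hausdorff_multM; first by apply: hausdorff_mult_cst; exact: expR_ge0.
  under eq_fun do rewrite addrAC.
  by apply: hausdorff_mult_inv; rewrite addr_gt0// expR_gt0.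
have mult1 : hausdorff_mult (fun i => expR ((nu - 1) * ln (1 + i%:R))).
  have -> : (fun i : nat => expR ((nu - 1) * ln (1 + i%:R))) =
      (fun i => (stieltjes_const nu)^-1 *
        \int[mu]_x (expR (nu * x) / (1 + i%:R + expR x))).
    apply/funext => i; rewrite (stieltjes_power_real (p0 i)).2 mulrA mulVf ?mul1r//.
    by rewrite gt_eqF.
  apply: hausdorff_multM; first by apply: hausdorff_mult_cst; rewrite invr_ge0 ltW.
  apply: (@hausdorff_mult_integral _ setT (fun i x => expR (nu * x) / (1 + i%:R + expR x))) => //.
  by move=> i; have [] := stieltjes_power_real (p0 i).
pose I n : set R := `[- n%:R, n%:R]%classic.
have mI n : measurable (I n) by exact: measurable_itv.
pose W n := (stieltjes_const nu)^-1 * \int[mu]_(x in I n) expR (nu * x).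
pose Hn n (i : nat) := (stieltjes_const nu)^-1 *
  \int[mu]_(x in I n) (expR x * (expR (nu * x) / (1 + i%:R + expR x))).
have intI n (f : R -> R) : continuous f -> mu.-integrable (I n) (EFin \o f).
  move=> cf; apply: continuous_compact_integrable; first exact: segment_compact.
  exact: continuous_subspaceT.
have cK i : continuous (fun x : R => expR (nu * x) / (1 + i%:R + expR x)).
  move=> x; apply: cvgM; first exact: expR_scale_continuous.
  apply: cvgV; first by rewrite gt_eqF// addr_gt0// expR_gt0.
  by apply: cvgD; [exact: cvg_cst|exact: continuous_expR].
have ceK i : continuous (fun x : R => expR x * (expR (nu * x) / (1 + i%:R + expR x))).
  by move=> x; apply: cvgM; [exact: continuous_expR|exact: cK].
have multH n : hausdorff_mult (Hn n).
  apply: hausdorff_multM; first by apply: hausdorff_mult_cst; rewrite invr_ge0 ltW.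
  apply: (@hausdorff_mult_integral _ (I n)
    (fun i x => expR x * (expR (nu * x) / (1 + i%:R + expR x)))) => //.
    by move=> i; apply: intI; exact: ceK.
  move=> x _; apply: hausdorff_multM => //.
  by apply: hausdorff_mult_cst; exact: expR_ge0.
have WH n i : W n - Hn n i = (stieltjes_const nu)^-1 *
    ((1 + i%:R) * \int[mu]_(x in I n) (expR (nu * x) / (1 + i%:R + expR x))).
  rewrite /W /Hn -mulrBr; congr (_ * _).
  have i1 := intI n _ (expR_scale_continuous (k := nu)).
  rewrite -(@RintegralB _ _ _ mu (I n) _ _ (mI n) i1 (intI n _ (ceK i))).
  rewrite -(@RintegralZl _ _ _ mu (I n) _ _ (mI n) (intI n _ (cK i))).
  apply: eq_Rintegral => x _.
  have d0 : 1 + i%:R + expR x != 0 by rewrite gt_eqF// addr_gt0// expR_gt0.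
  by field.
have WHlim i : W n - Hn n i @[n --> \oo] --> expR (nu * ln (1 + i%:R)).
  under eq_fun do rewrite WH.
  have [iK eK] := stieltjes_power_real (p0 i).
  have -> : expR (nu * ln (1 + i%:R)) = (stieltjes_const nu)^-1 *
      ((1 + i%:R) * \int[mu]_x (expR (nu * x) / (1 + i%:R + expR x))).
    have lnE : 1 + i%:R = expR (ln (1 + i%:R)) :> R by rewrite lnK// posrE.
    rewrite eK mulrCA mulKf ?gt_eqF// {2}lnE -expRD; congr expR; ring.
  apply: cvgM; first exact: cvg_cst.
  by apply: cvgM; [exact: cvg_cst|exact: cvg_Rintegral_symitv].
have mult2 : hausdorff_mult (fun i => expR (- (a * expR (nu * ln (1 + i%:R))))).
  apply: (@hausdorff_mult_cvg _ (fun n i => expR (- (a * W n)) * expR (a * Hn n i))).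
    move=> n; apply: hausdorff_multM; first by apply: hausdorff_mult_cst; exact: expR_ge0.
    apply: hausdorff_mult_expR; apply: hausdorff_multM => //.
    exact: hausdorff_mult_cst.
  move=> i; have -> : (fun n => expR (- (a * W n)) * expR (a * Hn n i)) =
      (fun n => expR (- (a * (W n - Hn n i)))).
    by apply/funext => n; rewrite -expRD; congr expR; ring.
  have lim : - (a * (W n - Hn n i)) @[n --> \oo] --> - (a * expR (nu * ln (1 + i%:R))).
    by apply: cvgN; apply: cvgM; [exact: cvg_cst|exact: WHlim].
  exact: (cvg_comp _ _ lim (@continuous_expR R _)).
have := mult1 _ (mult2 _ hausdorff_pos1).
by under eq_fun do rewrite mulr1.
Qed.

Lemma wright_real_laplace (a : R) : 0 <= a ->
  real_laplace (wright_density a) 0 (fun s => expR ((nu - 1) * ln s) *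
    expR (- (a * expR (nu * ln s)))).
Proof.
move=> a0 s s0; have := laplace_real (fun z z0 => wright_density_laplace a0 z0) s0.
have powE b : cpow s%:C b = (expR (b * ln s))%:C.
  rewrite (cpow_log b (s0 : 0 < Re s%:C)) cmod_real gtr0_norm// /carg /= lexx.
  rewrite cmod_real gtr0_norm// divff ?gt_eqF// acos1 real_mul_pair mulr0.
  by rewrite (cexp_real (b * ln s)).
rewrite !powE -rmorphN -rmorphM cexp_real -rmorphM opprB mulNr.
exact.
Qed.

Lemma wright_density_ge0 (a t : R) : 0 <= a -> 0 < t -> 0 <= wright_density a t.
Proof.
move=> a0 t0; have [cy _] := wright_density_is_inverse_laplace a0.
exact: (real_laplace_ge0 (wright_real_laplace a0) cy ltr01 (wright_laplace_hausdorff a0)).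
Qed.

End WrightDensity.

Section DensityInSpace.
Context {R : realType}.
Local Notation mu := (@lebesgue_measure R).
Local Notation D := (`]0%R, +oo[%classic : set R).
Variable nu : R.
Hypotheses (nu_gt0 : 0 < nu) (nu_le : nu <= 2^-1).
Local Notation h a := (fun x => expR (nu * x) * cut_density nu a x).

Definition wright_profile (a : R) : R := wright_density nu `|a| 1.
Local Notation N := wright_profile.

Definition self_scale (t : R) : R := expR (- (nu * ln t)).

(* Substitute x - ln t for x in the integral over the cut. *)
Lemma wright_density_scale (a t : R) : 0 <= a -> 0 < t ->
  wright_density nu a t = self_scale t * N (self_scale t * a).
Proof.
move=> a0 t0; have k0 : 0 < self_scale t by exact: expR_gt0.
have ka0 : 0 <= self_scale t * a by rewrite mulr_ge0// ltW.
rewrite /N (ger0_norm ka0) /wright_density mulrCA; congr (_ * _).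
set b := self_scale t * a.
pose f (x : R) := h b x * expR (- (1 * expR x)).
have cf : continuous f.
  move=> x; apply: cvgM; first exact: cut_integrand_continuous.
  exact: expR_expR_continuous_x.
have intf : mu.-integrable setT (EFin \o f).
  apply: (superposition_integrable nu_gt0 nu_le) => //.
    exact: cut_integrand_continuous.
  by move=> x; apply: cut_integrand_le.
have [ifs e] := integrable_shift (ln t) cf intf.
rewrite -[exp_superposition (h b) 1]/(\int[mu]_x f x)%R -e.
rewrite -(RintegralZl _ measurableT ifs); apply: eq_Rintegral => x _.
have exE : expR (nu * (x + ln t)) = expR (nu * x) / self_scale t.
  by rewrite /self_scale expRN invrK -expRD mulrDr.
have ecE : b * expR (nu * (x + ln t)) = a * expR (nu * x).
  by rewrite exE /b; field; rewrite gt_eqF.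
have etE : expR (- (1 * expR (x + ln t))) = expR (- (t * expR x)).
  by rewrite mul1r expRD (lnK t0) mulrC.
have cdE : cut_density nu b (x + ln t) = cut_density nu a x.
  by rewrite /cut_density ecE.
rewrite /f etE cdE exE.
by field; rewrite gt_eqF.
Qed.

Lemma wright_profile_ge0 a : 0 <= N a.
Proof. exact: wright_density_ge0. Qed.

Lemma wright_profile_continuous : continuous N.
Proof.
move=> a; apply: cvgM; first exact: cvg_cst.
have iK : mu.-integrable setT (EFin \o (fun x => (Num.min 1 1)^-1 * stieltjes_kernel nu x)).
  by apply: RintegrableZ => //; exact: stieltjes_kernel_integrable.
have := @continuity_under_integral R _ _ mu
  (fun a x => h `|a| x * expR (- (1 * expR x))) setT measurableT (a - 1) (a + 1) _ _
  (fun x => (Num.min 1 1)^-1 * stieltjes_kernel nu x).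
apply => //.
- move=> z _; apply: (superposition_integrable nu_gt0 nu_le) => //.
    exact: cut_integrand_continuous.
  by move=> x; apply: cut_integrand_le.
- apply: aeW => x _ z _; apply: cvgM; last exact: cvg_cst.
  apply: cvgM; first exact: cvg_cst.
  apply: (@continuous_comp _ _ _ (fun z : R => (`|z|, x))
    (fun p : R * R => cut_density nu p.1 p.2)); last exact: cut_density_continuous.
  apply: (@cvg_pair _ _ _ _ (nbhs `|z|) (nbhs x)); last exact: cvg_cst.
  by apply: cvg_norm; exact: cvg_id.
- move=> z _; apply: aeW => x _.
  have hle y : `|h `|z| y| <= expR (nu * y) by exact: cut_integrand_le.
  exact: (superposition_le hle x ltr01 (lexx 1)).
- by rewrite inE/= in_itv/=; apply/andP; split; lra.
Qed.

Lemma Rfun_wright (a t : R) : 0 <= a -> 0 < t ->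
  Rfun (1 - nu) nu a t = wright_density nu a t.
Proof.
move=> a0 t0; apply: (inverse_laplaceE _ t0).
exact: wright_density_is_inverse_laplace.
Qed.

Lemma pfun_profile (kappa x t : R) : 0 < kappa -> 0 < t ->
  pfun kappa nu x t = self_scale t / Num.sqrt kappa / 2 *
    N (self_scale t / Num.sqrt kappa * x).
Proof.
move=> k0 t0; have sk0 : 0 < Num.sqrt kappa by rewrite sqrtr_gt0.
have ax0 : 0 <= `|x| / Num.sqrt kappa by rewrite divr_ge0// ltW.
rewrite /pfun (Rfun_wright ax0 t0) (wright_density_scale ax0 t0).
have c0 : 0 < self_scale t by exact: expR_gt0.
have -> : N (self_scale t * (`|x| / Num.sqrt kappa)) = N (self_scale t / Num.sqrt kappa * x).
  rewrite /N; congr wright_density; rewrite !normrM normr_id.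
  by rewrite (gtr0_norm c0) normfV (gtr0_norm sk0); ring.
by field; rewrite gt_eqF.
Qed.

Lemma integral_affine_profile (k : R) : 0 < k ->
  (\int[mu]_x (k / 2 * N (k * x))%:E = \int[mu]_x (N x / 2)%:E)%E.
Proof.
move=> k0; rewrite [RHS](@ge0_integral_affine _ k 0 (fun x => N x / 2))//.
- by apply: eq_integral => x _; rewrite addr0; congr EFin; ring.
- by move=> x; apply: cvgM; [exact: wright_profile_continuous|exact: cvg_cst].
- by move=> x; rewrite divr_ge0// wright_profile_ge0.
Qed.

Lemma laplace_profile (x : R) :
  (\int[mu]_(t in D) (expR (- t) * (self_scale t * N (self_scale t * `|x|)))%:E =
   (expR (- `|x|))%:E)%E.
Proof.
have [i e] := wright_real_laplace nu_gt0 nu_le (normr_ge0 x) ltr01.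
have mD : measurable D by [].
transitivity (\int[mu]_(t in D) (expR (- (1 * t)) * wright_density nu `|x| t)%:E)%E.
  apply: eq_integral => t; rewrite inE/= in_itv/= andbT => t0.
  by rewrite wright_density_scale// mul1r.
move: e; rewrite /Rintegral; set I := integral _ _ _ => e.
have fI : I \is a fin_num by exact: integrable_fin_num.
rewrite -(fineK fI) e; congr EFin.
by rewrite ln1 !mulr0 expR0 mul1r mulr1.
Qed.

Lemma expRN_continuous : continuous (fun t : R => expR (- t)).
Proof.
move=> x; apply: (@continuous_comp _ _ _ (fun x : R => - x)).
  by apply: cvgN; exact: cvg_id.
exact: continuous_expR.
Qed.

Lemma integral_expRN : (\int[mu]_(t in D) (expR (- t))%:E = 1)%E.
Proof.
have mf A : measurable_fun A (fun t : R => (expR (- t))%:E).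
  apply/measurable_EFinP; apply: measurable_funTS.
  exact: (continuous_measurable_fun expRN_continuous).
rewrite integral_itv_obnd_cbnd// -(@integral_exponential_pdf R 1)//.
rewrite [LHS]integral_mkcond; apply: eq_integral => x _; rewrite patchE.
case: ifPn; rewrite ?notin_setE ?inE/= in_itv/= andbT => x0.
  by rewrite exponential_pdfE// mul1r mulN1r.
by rewrite lt0_exponential_pdf// ltNge; apply/negP.
Qed.

Lemma integral_half_laplace :
  (\int[mu]_x (expR (- `|x|) / 2)%:E = 1)%E.
Proof.
have cf : continuous (fun x : R => expR (- `|x|) / 2).
  move=> x; apply: cvgM; last exact: cvg_cst.
  apply: (@continuous_comp _ _ _ (fun x : R => `|x|) (fun t : R => expR (- t))).
    by apply: cvg_norm; exact: cvg_id.
  exact: expRN_continuous.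
rewrite ge0_symfun_integralT//; last by move=> x /=; rewrite normrN.
have mf A : measurable_fun A (fun x : R => (expR (- `|x|) / 2)%:E).
  apply/measurable_EFinP; apply: measurable_funTS.
  exact: (continuous_measurable_fun cf).
rewrite -set_itvcy -integral_itv_obnd_cbnd//.
rewrite -ge0_integralZl//; last exact: mf.
rewrite -integral_expRN; apply: eq_integral => x; rewrite inE/= in_itv/= andbT => x0.
by rewrite gtr0_norm// -EFinM; congr EFin; field.
Qed.

Lemma wright_profile_mass : (\int[mu]_x (N x / 2)%:E = 1)%E.
Proof.
have mD : measurable D by [].
have NE (k x : R) : N (k * `|x|) = N (k * x) by rewrite /N !normrM normr_id.
have s0 (t : R) : 0 < self_scale t by exact: expR_gt0.
pose c t : R := expR (- t) * self_scale t / 2.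
pose F (p : R * R) : \bar R := ((c \_ D) p.1 * N (self_scale p.1 * `|p.2|))%:E.
have mss : measurable_fun setT self_scale.
  apply: (measurableT_comp (@measurable_expR R)); apply: measurableT_comp => //.
  by apply: measurable_funM => //; exact: measurable_ln.
have mexpN : measurable_fun setT (fun t : R => expR (- t)).
  exact: continuous_measurable_fun expRN_continuous.
have mc : measurable_fun setT c by do 2 apply: measurable_funM => //.
have mcD : measurable_fun setT (c \_ D).
  by apply/(measurable_restrictT _ _).1 => //; exact: measurable_funTS.
have mN : measurable_fun setT N := continuous_measurable_fun wright_profile_continuous.
have mF : measurable_fun setT F.
  apply/measurable_EFinP; apply: measurable_funM.
    exact: (measurableT_comp mcD measurable_fst).
  apply: (measurableT_comp mN).
  apply: measurable_funM; first exact: (measurableT_comp mss measurable_fst).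
  exact: (measurableT_comp (@normr_measurable R setT) measurable_snd).
have cD0 t : 0 <= (c \_ D) t.
  by rewrite patchE; case: ifP => // _; rewrite /c divr_ge0// mulr_ge0// expR_ge0.
have F0 p : (0 <= F p)%E by rewrite lee_fin mulr_ge0// wright_profile_ge0.
set M := (X in X = 1%E).
have M0 : (0 <= M)%E by apply: integral_ge0 => x _; rewrite lee_fin divr_ge0// wright_profile_ge0.
have I1 t : (\int[mu]_x F (t, x) = ((fun t => expR (- t)) \_ D t)%:E * M)%E.
  rewrite /F/= !patchE; case: ifPn => tD; last first.
    by rewrite mul0e integral0_eq// => x _; rewrite mul0r.
  have mNt : measurable_fun setT (fun x => (self_scale t / 2 * N (self_scale t * x))%:E).
    apply/measurable_EFinP; apply: measurable_funM => //.
    by apply: (measurableT_comp mN); exact: measurable_funM.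
  rewrite /M -(integral_affine_profile (s0 t)) -ge0_integralZl//.
  - by apply: eq_integral => x _; rewrite NE -EFinM /c; congr EFin; ring.
  - by move=> x _; rewrite lee_fin mulr_ge0 ?wright_profile_ge0// divr_ge0// ltW.
have I2 x : (\int[mu]_t F (t, x) = (expR (- `|x|) / 2)%:E)%E.
  pose g t := expR (- t) * (self_scale t * N (self_scale t * `|x|)).
  have mg : measurable_fun D (EFin \o g).
    apply/measurable_EFinP; apply: measurable_funTS; apply: measurable_funM => //.
    by apply: measurable_funM => //; apply: (measurableT_comp mN); exact: measurable_funM.
  transitivity (\int[mu]_(t in D) ((2^-1)%:E * (EFin \o g) t))%E.
    rewrite [RHS]integral_mkcond; apply: eq_integral => t _.
    rewrite /F /= !patchE; case: ifP => _; last by rewrite mul0r.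
    by rewrite -EFinM /c /g; congr EFin; ring.
  rewrite ge0_integralZl//.
  - by rewrite laplace_profile -EFinM mulrC.
  - move=> t _; rewrite lee_fin mulr_ge0 ?expR_ge0// mulr_ge0 ?wright_profile_ge0//.
    exact: ltW.
have := @fubini_tonelli _ _ _ _ _ mu mu F mF F0.
have L t : (\int[mu]_x F (t, x) = M * ((fun t => expR (- t)) \_ D t)%:E)%E.
  by rewrite I1 muleC.
rewrite (funext L) (funext I2) => fub; move: (etrans fub integral_half_laplace).
rewrite ge0_integralZl//; first last.
- by move=> t _; rewrite lee_fin patchE; case: ifP => // _; rewrite expR_ge0.
- apply/measurable_EFinP; apply/(measurable_restrictT _ _).1 => //.
  exact: measurable_funTS.
suff -> : (\int[mu]_t ((fun t : R => expR (- t)) \_ D t)%:E = 1)%E by rewrite mule1.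
rewrite -integral_expRN [RHS]integral_mkcond; apply: eq_integral => t _.
by rewrite !patchE; case: ifP.
Qed.

End DensityInSpace.

Section DensityProbability.
Context {R : realType}.
Local Notation mu := (@lebesgue_measure R).
Local Notation T := (measurableTypeR R).

Definition prob_density : Type :=
  {f : R -> R | [/\ measurable_fun setT f, (forall x, 0 <= f x) &
                    (\int[mu]_x (f x)%:E = 1)%E]}.

Variable f : prob_density.

Definition density_prob (A : set T) : \bar R := (\int[mu]_(x in A) (sval f x)%:E)%E.

Let density_prob0 : density_prob set0 = 0%E.
Proof. exact: integral_set0. Qed.

Let density_prob_ge0 A : (0 <= density_prob A)%E.
Proof. by have [_ f0 _] := svalP f; apply: integral_ge0 => x _; rewrite lee_fin. Qed.

Let density_prob_sigma_additive : semi_sigma_additive density_prob.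
Proof.
have [mf f0 f1] := svalP f; move=> /= F mF tF mUF.
have mfA A : measurable_fun A (fun x => (sval f x)%:E).
  by apply/measurable_EFinP; exact: measurable_funTS.
rewrite /density_prob/= ge0_integral_bigcup//.
- by apply: is_cvg_ereal_nneg_natsum_cond => n _ _; exact: density_prob_ge0.
- by apply: mfA.
- by move=> x _; rewrite lee_fin.
Qed.

HB.instance Definition _ := isMeasure.Build _ _ _
  density_prob density_prob0 density_prob_ge0 density_prob_sigma_additive.

Let density_prob_setT : density_prob [set: _] = 1%E.
Proof. by have [_ _ f1] := svalP f. Qed.

HB.instance Definition _ :=
  @Measure_isProbability.Build _ _ R density_prob density_prob_setT.

End DensityProbability.

Section IdentityVariable.
Context {R : realType}.
Definition id_real : measurableTypeR R -> R := idfun.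
HB.instance Definition _ :=
  isMeasurableFun.Build _ _ _ _ id_real (@measurable_id _ _ setT).
End IdentityVariable.

Lemma ex_is_pdf (R : realType) (f : R -> R) :
  measurable_fun setT f -> (forall x, 0 <= f x) ->
  (\int[@lebesgue_measure R]_x (f x)%:E = 1)%E ->
  exists (d : measure_display) (T : measurableType d)
    (P : probability T R) (X : {RV P >-> R}), is_pdf X f.
Proof.
move=> mf f0 f1.
pose F : prob_density := exist _ f (And3 mf f0 f1).
exists _, (measurableTypeR R), (density_prob F).
by exists (id_real : {RV (density_prob F) >-> R}); split.
Qed.

Section GaussianFourier.
Context {R : realType}.
Local Notation mu := (@lebesgue_measure R).
Local Notation q x := (expR (2^-1 * x)).

Lemma Rintegral_line_FTC (f F : R -> R) (l m : R) :
  (forall t, is_derive t (1 : R) F (f t)) -> continuous f ->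
  mu.-integrable setT (EFin \o f) ->
  F n%:R @[n --> \oo] --> l -> F (- n%:R) @[n --> \oo] --> m ->
  \int[mu]_t f t = l - m.
Proof.
move=> dF cf intf Fl Fm.
have := cvg_Rintegral_symitv intf.
rewrite -(cvg_shiftS (fun n : nat => \int[mu]_(x in `[- n%:R, n%:R]) f x)) => lim1.
have FE n : \int[mu]_(x in `[- n.+1%:R, n.+1%:R]) f x = F n.+1%:R - F (- n.+1%:R).
  have n0 : - n.+1%:R < n.+1%:R :> R by rewrite -subr_gt0 opprK addr_gt0 ?ltr0n.
  have cF : continuous F.
    by move=> x; apply: derivable_continuous; have [] := dF x.
  rewrite /Rintegral (@continuous_FTC2 _ f F)//.
  - exact: continuous_subspaceT.
  - split; first by move=> x _; have [] := dF x.
      by apply: cvg_at_right_filter; exact: cF.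
    by apply: cvg_at_left_filter; exact: cF.
  - by move=> x _; rewrite derive1E; have [] := dF x.
rewrite (funext FE) in lim1.
have lim2 : F n.+1%:R - F (- n.+1%:R) @[n --> \oo] --> l - m.
  apply: cvgB.
    by rewrite (cvg_shiftS (fun n : nat => F n%:R)).
  by rewrite (cvg_shiftS (fun n : nat => F (- n%:R))).
by rewrite -(cvg_lim (@Rhausdorff R) lim1) (cvg_lim (@Rhausdorff R) lim2).
Qed.

Let half_gt0 : 0 < 2^-1 :> R. Proof. by []. Qed.

Let qq (x : R) : q x * q x = expR x.
Proof. by rewrite -expRD; congr expR; field. Qed.

Let qc : continuous (fun x : R => q x).
Proof. exact: expR_scale_continuous. Qed.

Let q_derive (x : R) : is_derive x (1 : R) (fun x => q x) (q x / 2).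
Proof.
have d : is_derive x (1 : R) ( *%R (2^-1)) 2^-1.
  have := is_deriveZ (2^-1) (is_derive_id x (1 : R)).
  by rewrite /GRing.scale/= mulr1.
exact: (is_derive1_comp (is_derive_expR _) d).
Qed.

Lemma gauss_bound_integrable :
  mu.-integrable setT (EFin \o (fun x => q x * expR (- (2^-1 * expR x)))).
Proof.
apply: (superposition_integrable half_gt0 (lexx _)) => //.
by move=> x; rewrite ger0_norm ?expR_ge0.
Qed.

Lemma gauss_bound_ge (x : R) :
  q x * expR (- expR x) <= q x * expR (- (2^-1 * expR x)) /\
  expR x * expR (- expR x) <= q x * expR (- (2^-1 * expR x)).
Proof.
have ex0 := expR_gt0 x; split.
  rewrite ler_wpM2l ?expR_ge0// ler_expR lerN2 ler_piMl ?expR_ge0//.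
  by rewrite invf_le1// ler1n.
rewrite -{1}(qq x) -mulrA ler_wpM2l ?expR_ge0// -expRD ler_expR.
have := expR_ge1Dx x; set e := expR x; set h := 2^-1.
have : h * 2 = 1 by rewrite /h mulVf.
have : 0 < h by [].
nra.
Qed.

Definition gauss_cos (a : R) : R := \int[mu]_x (q x * cos (a * q x) * expR (- expR x)).

Let gc (a x : R) : R := q x * cos (a * q x) * expR (- expR x).
Let gs (a x : R) : R := expR x * sin (a * q x) * expR (- expR x).

Let expNexp_continuous : continuous (fun x : R => expR (- expR x)).
Proof.
by have := @expR_expR_continuous_x R 1; under eq_fun do rewrite mul1r.
Qed.

Let aq_continuous (a : R) : continuous (fun x : R => a * q x).
Proof. by move=> x; apply: cvgM; [exact: cvg_cst|exact: qc]. Qed.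

Let gc_continuous a : continuous (gc a).
Proof.
move=> x; apply: cvgM; last exact: expNexp_continuous.
apply: cvgM; first exact: qc.
apply: (@continuous_comp _ _ _ (fun x : R => a * q x) cos); first exact: aq_continuous.
exact: continuous_cos.
Qed.

Let gs_continuous a : continuous (gs a).
Proof.
move=> x; apply: cvgM; last exact: expNexp_continuous.
apply: cvgM; first exact: continuous_expR.
apply: (@continuous_comp _ _ _ (fun x : R => a * q x) sin); first exact: aq_continuous.
exact: continuous_sin.
Qed.

Let cos_norm (y : R) : `|cos y| <= 1.
Proof. by rewrite ler_norml cos_geN1 cos_le1. Qed.

Let sin_norm (y : R) : `|sin y| <= 1.
Proof. by rewrite ler_norml sin_geN1 sin_le1. Qed.

Let gc_le a x : `|gc a x| <= q x * expR (- (2^-1 * expR x)).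
Proof.
apply: le_trans (gauss_bound_ge x).1.
rewrite /gc !normrM !(ger0_norm (expR_ge0 _)) ler_wpM2r ?expR_ge0//.
by rewrite ler_piMr ?expR_ge0.
Qed.

Let gs_le a x : `|gs a x| <= q x * expR (- (2^-1 * expR x)).
Proof.
apply: le_trans (gauss_bound_ge x).2.
rewrite /gs !normrM !(ger0_norm (expR_ge0 _)) ler_wpM2r ?expR_ge0//.
by rewrite ler_piMr ?expR_ge0.
Qed.

Let gc_integrable a : mu.-integrable setT (EFin \o gc a).
Proof.
exact: (continuous_integrable_dominated (@gc_continuous a) (gc_le a) gauss_bound_integrable).
Qed.

Let gs_integrable a : mu.-integrable setT (EFin \o gs a).
Proof.
exact: (continuous_integrable_dominated (@gs_continuous a) (gs_le a) gauss_bound_integrable).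
Qed.

Let cvg_expRNn : expR (- n%:R) @[n --> \oo] --> (0 : R).
Proof. exact: cvg_comp (@cvgr_idn R) (@cvgr_expR R). Qed.

Let cvg_half_expRNn : expR (2^-1 * - n%:R) @[n --> \oo] --> (0 : R).
Proof.
have l : 2^-1 * x @[x --> +oo] --> (+oo : set_system R).
  by apply: gt0_cvgMry => //; exact: cvg_id.
have := cvg_comp _ _ (cvg_comp _ _ (@cvgr_idn R) l) (@cvgr_expR R).
by under [in X in _ -> X]eq_fun do rewrite mulrN.
Qed.

Let sin_derive (a x : R) :
  is_derive x (1 : R) (fun x => sin (a * q x)) (cos (a * q x) * (a * (q x / 2))).
Proof.
have d : is_derive x (1 : R) (fun x => a * q x) (a * (q x / 2)).
  exact: (is_deriveZ a (q_derive x)).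
exact: (is_derive1_comp (is_derive_sin _) d).
Qed.

Let expN_derive (x : R) :
  is_derive x (1 : R) (fun x => expR (- expR x)) (expR (- expR x) * - expR x).
Proof.
have d : is_derive x (1 : R) (fun x => - expR x) (- expR x).
  exact: (is_deriveN (is_derive_expR x)).
exact: (is_derive1_comp (is_derive_expR _) d).
Qed.

Lemma gauss_by_parts a : a / 2 * gauss_cos a = \int[mu]_x gs a x.
Proof.
pose Phi x := sin (a * q x) * expR (- expR x).
have dPhi x : is_derive x (1 : R) Phi (a / 2 * gc a x - gs a x).
  apply: (is_derive_eq (is_deriveM (sin_derive a x) (expN_derive x))).
  by rewrite /gc /gs /GRing.scale/=; ring.
have ig : mu.-integrable setT (EFin \o (fun x => a / 2 * gc a x)).
  by apply: RintegrableZ => //; exact: gc_integrable.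
have := Rintegral_line_FTC (l := 0) (m := 0) dPhi.
rewrite subrr => ftc; apply/eqP; rewrite -subr_eq0; apply/eqP.
rewrite -(RintegralZl _ measurableT (gc_integrable a)).
rewrite -(RintegralB measurableT ig (gs_integrable a)); apply: ftc.
- move=> x; apply: cvgB; last exact: gs_continuous.
  by apply: cvgM; [exact: cvg_cst|exact: gc_continuous].
- exact: (RintegrableB measurableT ig (gs_integrable a)).
- apply/norm_cvg0P; apply: (squeeze_cvgr _ (cvg_cst 0) cvg_expRNn).
  apply: nearW => n; rewrite normr_ge0/= normrM (ger0_norm (expR_ge0 _)).
  rewrite -[leRHS]mul1r ler_pM ?expR_ge0// ler_expR lerN2.
  by apply: le_trans (expR_ge1Dx _); rewrite lerDr.
- rewrite /Phi; have -> : (0 : R) = sin (a * 0) * expR (- 0) by rewrite mulr0 sin0 mul0r.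
  have l1 : a * q (- n%:R) @[n --> \oo] --> a * 0.
    by apply: cvgM; [exact: cvg_cst|exact: cvg_half_expRNn].
  have l2 : - expR (- n%:R) @[n --> \oo] --> - (0 : R).
    by apply: cvgN; exact: cvg_expRNn.
  exact: (cvgM (cvg_comp _ _ l1 (@continuous_sin R _)) (cvg_comp _ _ l2 (@continuous_expR R _))).
Qed.

Let gc_derive (x a : R) : is_derive a (1 : R) (gc ^~ x) (- gs a x).
Proof.
have d1 : is_derive a (1 : R) (fun a => a * q x) (q x).
  have := is_deriveZ (q x) (is_derive_id a (1 : R)).
  rewrite /GRing.scale/= mulr1.
  have -> : q x \*: id = (fun a => a * q x); last by [].
  by apply/funext => b; exact: mulrC.
have d2 := @is_derive1_comp R cos (fun a => a * q x) a _ _ (is_derive_cos _) d1.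
have d3 := is_deriveZ (q x * expR (- expR x)) d2.
rewrite (_ : gc ^~ x = (q x * expR (- expR x)) \*: (cos \o (fun a => a * q x))); last first.
  by apply/funext => b; rewrite /gc /= mulrAC.
apply: (is_derive_eq d3).
by rewrite /GRing.scale/= /gs -(qq x); ring.
Qed.

Lemma gauss_cos_derive (a : R) : is_derive a (1 : R) gauss_cos (- (a / 2) * gauss_cos a).
Proof.
have Ia : (`]a - 1, a + 1[%classic : set R) a.
  by rewrite /= in_itv/=; apply/andP; split; lra.
have p1 b x : partial1of2 gc b x = - gs b x.
  by rewrite partial1of2E; have [_ ->] := gc_derive x b.
have dg x y : (`]a - 1, a + 1[%classic : set R) x -> [set: R] y -> derivable (gc ^~ y) x 1.
  by move=> _ _; have [] := gc_derive y x.
have bg x y : (`]a - 1, a + 1[%classic : set R) x -> [set: R] y ->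
    `|partial1of2 gc x y| <= q y * expR (- (2^-1 * expR y)).
  by move=> _ _; rewrite p1 normrN.
have g0 (y : R) : 0 <= q y * expR (- (2^-1 * expR y)) by rewrite mulr_ge0 ?expR_ge0.
apply: DeriveDef.
  exact: (@derivable_under_integral _ _ _ mu gc setT measurableT a (a - 1) (a + 1) Ia
    (fun x _ => gc_integrable x) dg _ g0 gauss_bound_integrable bg).
rewrite -derive1E.
rewrite (@differentiation_under_integral _ _ _ mu gc setT measurableT a (a - 1) (a + 1) Ia
    (fun x _ => gc_integrable x) dg _ g0 gauss_bound_integrable bg).
rewrite (funext (p1 a)) mulNr gauss_by_parts.
rewrite -[RHS]mulN1r -(RintegralZl _ measurableT (gs_integrable a)).
by apply: eq_Rintegral => x _; rewrite mulN1r.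
Qed.

Lemma gauss_cosE (a : R) : gauss_cos a = gauss_cos 0 * expR (- (a ^+ 2 / 4)).
Proof.
pose P a := gauss_cos a * expR (a ^+ 2 / 4).
have dP b : is_derive b (1 : R) P 0.
  have d1 : is_derive b (1 : R) (fun b => b ^+ 2 / 4) (b / 2).
    have := is_deriveZ (4^-1) (is_deriveX 2 (is_derive_id b (1 : R))).
    rewrite (_ : _ \*: (id ^+ 2) = (fun b : R => b ^+ 2 / 4)); last first.
      by apply/funext => c; rewrite /GRing.scale/= mulrC.
    move=> d; apply: (is_derive_eq d).
    by rewrite /GRing.scale/= expr1; field.
  have d2 := is_derive1_comp (is_derive_expR _) d1.
  apply: (is_derive_eq (is_deriveM (gauss_cos_derive b) d2)).
  by rewrite /GRing.scale/=; ring.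
have := is_derive_0_is_cst a 0 dP; rewrite /P expr0n mul0r expR0 mulr1 => <-.
by rewrite -mulrA -expRD subrr expR0 mulr1.
Qed.

Lemma wright_profile_half (a : R) :
  wright_profile 2^-1 a = wright_profile 2^-1 0 * expR (- (a ^+ 2 / 4)).
Proof.
have E b : wright_profile 2^-1 b =
    (stieltjes_const 2^-1 * sin (2^-1 * pi))^-1 * gauss_cos `|b|.
  rewrite /wright_profile /wright_density; congr (_ * _).
  apply: eq_Rintegral => x _; rewrite mul1r; congr (_ * _ * _).
  rewrite /cut_density; have -> : 2^-1 * pi = pi / 2 :> R by rewrite mulrC.
  rewrite cos_pihalf sin_pihalf mulr0 oppr0 expR0 mul1r mulr1.
  by rewrite -opprB sinN sinBpihalf opprK.
by rewrite !E gauss_cosE normr0 mulrA real_normK ?num_real.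
Qed.

End GaussianFourier.

Section Solution.
Context {R : realType}.
Local Notation mu := (@lebesgue_measure R).
Variables (kappa nu t : R).
Hypotheses (kappa_gt0 : 0 < kappa) (nu_gt0 : 0 < nu) (nu_le : nu <= 2^-1).
Hypothesis (t_gt0 : 0 < t).
Let k := self_scale nu t / Num.sqrt kappa.

Let k_gt0 : 0 < k.
Proof. by rewrite divr_gt0 ?expR_gt0 ?sqrtr_gt0. Qed.

Let pfunE x : pfun kappa nu x t = k / 2 * wright_profile nu (k * x).
Proof. exact: pfun_profile. Qed.

Lemma pfun_ge0 x : 0 <= pfun kappa nu x t.
Proof. by rewrite pfunE mulr_ge0 ?wright_profile_ge0// divr_ge0// ltW. Qed.

Lemma measurable_pfun : measurable_fun setT (fun x => pfun kappa nu x t).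
Proof.
rewrite (funext pfunE); apply: measurable_funM => //.
apply: (measurableT_comp (continuous_measurable_fun (wright_profile_continuous nu_gt0 nu_le))).
exact: measurable_funM.
Qed.

Lemma integral_pfun : (\int[mu]_x (pfun kappa nu x t)%:E = 1)%E.
Proof.
rewrite (funext (fun x => congr1 EFin (pfunE x))).
by rewrite integral_affine_profile// wright_profile_mass.
Qed.

End Solution.

Lemma pfun_half_normal (R : realType) (x t : R) : 0 < t ->
  pfun 2^-1 2^-1 x t = normal_pdf 0 (Num.sqrt t) x.
Proof.
move=> t0; have h0 : 0 < 2^-1 :> R by [].
have s0 : 0 < Num.sqrt t by rewrite sqrtr_gt0.
have sn0 : Num.sqrt t != 0 by rewrite gt_eqF.
pose k := self_scale 2^-1 t / Num.sqrt (2^-1 : R).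
have k2 : k ^+ 2 = 2 / t.
  rewrite /k expr_div_n sqr_sqrtr ?ltW// invrK /self_scale -expRM_natl mulrN.
  have -> : 2%:R * (2^-1 * ln t) = ln t :> R by field.
  by rewrite expRN lnK// mulrC.
pose c := k / 2 * wright_profile 2^-1 0 / normal_peak (Num.sqrt t).
have p0 : 0 < normal_peak (Num.sqrt t) by exact: normal_peak_gt0.
have pE y : pfun 2^-1 2^-1 y t = c * normal_pdf 0 (Num.sqrt t) y.
  rewrite (pfun_profile h0 (lexx _) _ h0 t0) -/k wright_profile_half normal_pdfE// /normal_fun.
  rewrite subr0 sqr_sqrtr ?ltW// /c.
  have -> : - ((k * y) ^+ 2 / 4) = - y ^+ 2 / (t *+ 2).
    by rewrite exprMn k2; field; rewrite gt_eqF.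
  by field; rewrite gt_eqF.
have : (\int[@lebesgue_measure R]_y (pfun 2^-1 2^-1 y t)%:E = 1)%E.
  exact: integral_pfun.
have c0 : 0 <= c.
  rewrite divr_ge0 ?(ltW p0)// mulr_ge0 ?wright_profile_ge0// divr_ge0// ltW//.
  by rewrite divr_gt0 ?expR_gt0 ?sqrtr_gt0.
have pE' y : ((pfun 2^-1 2^-1 y t)%:E = c%:E * (normal_pdf 0 (Num.sqrt t) y)%:E)%E.
  by rewrite -EFinM pE.
rewrite (funext pE') ge0_integralZl//.
- rewrite integral_normal_pdf mule1 => -[c1].
  by rewrite pE c1 mul1r.
- apply/measurable_EFinP; exact: measurable_normal_pdf.
- by move=> y _; rewrite lee_fin normal_pdf_ge0.
Qed.

Theorem mainTheorem4 (R : realType) (kappa nu : R)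
    (hkappa : 0 < kappa) (hnu0 : 0 < nu) (hnu1 : nu <= 2^-1)
    (t : R) (ht : 0 < t) :
  (exists (d : measure_display) (T : measurableType d)
     (P : probability T R) (X : {RV P >-> R}),
     is_pdf X (fun x => pfun kappa nu x t)) /\
  (nu = 2^-1 -> kappa = 2^-1 ->
   forall (d : measure_display) (T : measurableType d)
     (P : probability T R) (X : {RV P >-> R}),
     is_pdf X (fun x => pfun kappa nu x t) ->
     forall A : set R, measurable A ->
       distribution P X A = normal_prob 0 (Num.sqrt t) A).
Proof.
split.
  apply: ex_is_pdf; [exact: measurable_pfun|exact: pfun_ge0|exact: integral_pfun].
move=> -> -> d T P X [_ _ dX] A mA; rewrite dX//.
by apply: eq_integral => x _; rewrite pfun_half_normal.
Qed.
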